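(* Let $P\subseteq\mathbb{R}$ with the usual total order and let $K$ be a field. Let $M:P\to\mathbf{Vect}_K$ be a direct sum of interval modules and let $I$ be an interval module. Given a nonzero map $f:M\to I$, there exists an isomorphism $\theta:M\to N\oplus\bigoplus_{\alpha\in A}M_\alpha$, with each $M_\alpha$ an interval module, such that: - $f\theta^{-1}i_N=0$, and for all $\alpha\in A$, $I\le M_\alpha$, $M_\alpha\cap I\neq\emptyset$, and $f\theta^{-1}i_\alpha$ is nonzero; - $\operatorname{coker}f= I\setminus\bigcup_{\alpha\in A}M_\alpha$; - if $A$ is finite, then $\bigoplus_{\alpha\in A}M_\alpha\cong\bigoplus_{j=1}^nM_j$ for some $n\ge1$, where $M_1\Supset M_2\Supset\cdots\Supset M_n$, and if $I$ does not have an upper bound then $n=1$; furthermore, in this case, $\operatorname{coker}f= I\setminus M_1$ and $$\ker f\cong N\oplus(M_n\setminus I)\oplus\bigoplus_{j=1}^{n-1}M_j\setminus\big((M_j\setminus M_{j+1})\cap I\big).$$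
   Context: $P$ is viewed as a category via $\le$; a persistence module is a functor $P\to\mathbf{Vect}_K$. An interval in $P$ is a nonempty convex subset. The interval module of an interval $I$, also denoted $I$, has value $K$ at points of $I$, $0$ elsewhere, and identity maps between points of $I$. Set-theoretic expressions such as $I\setminus M_1$, $M_\alpha\cap I$, $M_n\setminus I$ refer to the corresponding subsets of $P$; when used as modules they denote the corresponding interval modules (the zero module if the set is empty), and equality of modules means isomorphism. Persistence modules in this statement, including $N$, are understood to be isomorphic to direct sums of interval modules. The maps $i_N:N\to N\oplus\bigoplus_{\alpha}M_\alpha$ and $i_\alpha:M_\alpha\to N\oplus\bigoplus_{\alpha}M_\alpha$ are the canonical inclusions. For intervals $I,J\subseteq P$, $I\le J$ means: for all $i\in I$ there exists $j\in J$ with $i\le j$, and for all $j\in J$ there exists $i\in I$ with $i\le j$. Write $J\Supset I$ if $I\subset J$ and there exist $a,b\in J$ such that $a<i<b$ for all $i\in I$. *)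

(* Defs.v *)
From HB Require Import structures.
From mathcomp Require Import all_boot all_order all_algebra.
From mathcomp Require Import all_classical all_reals.

Set Implicit Arguments.
Unset Strict Implicit.
Unset Printing Implicit Defensive.

Import Order.TTheory GRing.Theory Num.Theory.
Local Open Scope classical_set_scope.
Local Open Scope ring_scope.
Local Open Scope quotient_scope.

Section KerCoker.
Variables (K : fieldType) (V W : lmodType K) (g : {linear V -> W}).

Definition kernel_pred : {pred V} := [pred v | g v == 0].

Lemma kernel_submod : submod_closed kernel_pred.
Proof.
split=> [|a u v]; rewrite !inE ?linear0 // => /eqP gu /eqP gv.
by rewrite linearP gu gv scaler0 addr0.
Qed.
HB.instance Definition _ :=
  GRing.isSubmodClosed.Build K V kernel_pred kernel_submod.

Record kernel := Kernel { kernel_val : V; _ : kernel_val \in kernel_pred }.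
HB.instance Definition _ := [isSub for kernel_val].
HB.instance Definition _ := [Choice of kernel by <:].
HB.instance Definition _ := [SubChoice_isSubLmodule of kernel by <:].

Definition image_pred : {pred W} := [pred w | `[< exists v, g v = w >]].

Lemma image_predP w : reflect (exists v, g v = w) (w \in image_pred).
Proof. exact: asboolP. Qed.

Lemma image_submod : submod_closed image_pred.
Proof.
split=> [|a u v]; first by apply/image_predP; exists 0; rewrite linear0.
move=> /image_predP[u' <-] /image_predP[v' <-].
by apply/image_predP; exists (a *: u' + v'); rewrite linearP.
Qed.
HB.instance Definition _ :=
  GRing.isSubmodClosed.Build K W image_pred image_submod.

Definition cokernel : Type := Quotient.quot image_pred.
HB.instance Definition _ := GRing.Zmodule.on cokernel.
HB.instance Definition _ := EqQuotient.on cokernel.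
HB.instance Definition _ :=
  ZmodQuotient.copy cokernel (Quotient.quot image_pred).

Lemma coker_pi_eq u v : u - v \in image_pred -> \pi_cokernel u = \pi_cokernel v.
Proof. by move=> h; apply/eqP; rewrite -Quotient.idealrBE. Qed.

Lemma coker_repr u : exists2 v : V, u = repr (\pi_cokernel u) + g v & True.
Proof.
suff /image_predP[v gv] : u - repr (\pi_cokernel u) \in image_pred.
  by exists v => //; rewrite gv addrC subrK.
by rewrite Quotient.idealrBE reprK.
Qed.

Definition coker_pi (w : W) : cokernel := \pi_cokernel w.

Lemma coker_piD : {morph coker_pi : u v / u + v}.
Proof. exact: (@pi_addr _ _ _ _ _ cokernel). Qed.

Lemma coker_piP q : exists w, q = coker_pi w.
Proof. by exists (repr q); rewrite /coker_pi reprK. Qed.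

Definition coker_scale (a : K) (q : cokernel) : cokernel :=
  coker_pi (a *: repr q).

Lemma coker_piZ a u : coker_scale a (coker_pi u) = coker_pi (a *: u).
Proof.
have [v {2}-> _] := coker_repr u; apply: coker_pi_eq; apply/image_predP.
by exists (a *: (- v)); rewrite linearZ linearN -scalerBr opprD addrA subrr sub0r.
Qed.

Lemma coker_scaleA a b q : coker_scale a (coker_scale b q) = coker_scale (a * b) q.
Proof. by have [u ->] := coker_piP q; rewrite !coker_piZ scalerA. Qed.
Lemma coker_scale1 : left_id 1 coker_scale.
Proof. by move=> q; have [u ->] := coker_piP q; rewrite coker_piZ scale1r. Qed.
Lemma coker_scaleDr : right_distributive coker_scale +%R.
Proof.
move=> a p q; have [u ->] := coker_piP p; have [v ->] := coker_piP q.
by rewrite !(coker_piZ, =^~ coker_piD) scalerDr.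
Qed.
Lemma coker_scaleDl q : {morph coker_scale^~ q : a b / a + b}.
Proof.
move=> a b; have [u ->] := coker_piP q.
by rewrite !(coker_piZ, =^~ coker_piD) scalerDl.
Qed.
HB.instance Definition _ := GRing.Zmodule_isLmodule.Build K cokernel
  coker_scaleA coker_scale1 coker_scaleDr coker_scaleDl.

Lemma coker_pi_is_linear : linear coker_pi.
Proof. by move=> a u v; rewrite coker_piD -coker_piZ. Qed.
HB.instance Definition _ :=
  GRing.isLinear.Build K W cokernel _ coker_pi coker_pi_is_linear.

Lemma coker_pi_surj q : exists w, coker_pi w = q.
Proof. by have [w ->] := coker_piP q; exists w. Qed.

Lemma coker_pi_eq0 w : coker_pi w = 0 <-> exists v, g v = w.
Proof.
split=> [|[v <-]].
  rewrite -(linear0 coker_pi) => /eqP; rewrite -Quotient.idealrBE subr0.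
  by move/image_predP.
by rewrite -(linear0 coker_pi); apply: coker_pi_eq; rewrite subr0;
   apply/image_predP; exists v.
Qed.
End KerCoker.

Section InducedMaps.
Variables (K : fieldType) (V W V' W' : lmodType K).
Variables (g : {linear V -> W}) (g' : {linear V' -> W'}).
Variables (hV : {linear V -> V'}) (hW : {linear W -> W'}).
Hypothesis hgg' : forall v, g' (hV v) = hW (g v).

Fact kernel_map_subproof (v : kernel g) : hV (kernel_val v) \in kernel_pred g'.
Proof. by case: v => v /=; rewrite !inE hgg' => /eqP->; rewrite linear0. Qed.
Definition kernel_map (v : kernel g) : kernel g' :=
  Kernel (kernel_map_subproof v).

Lemma kernel_map_is_linear : linear kernel_map.
Proof. by move=> a u v; apply: val_inj; rewrite /= linearP. Qed.
HB.instance Definition _ := GRing.isLinear.Build K (kernel g) (kernel g') _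
  kernel_map kernel_map_is_linear.

Definition cokernel_map (q : cokernel g) : cokernel g' :=
  coker_pi g' (hW (repr q)).

Lemma cokernel_map_pi w : cokernel_map (coker_pi g w) = coker_pi g' (hW w).
Proof.
have [v {2}-> _] := coker_repr g w; apply: coker_pi_eq; apply/image_predP.
by exists (- hV v); rewrite linearN hgg' linearD opprD addrA subrr sub0r.
Qed.

Lemma cokernel_map_is_linear : linear cokernel_map.
Proof.
move=> a p q; have [u ->] := coker_piP p; have [v ->] := coker_piP q.
by rewrite -linearP !cokernel_map_pi !linearP.
Qed.
Definition cokernel_lin : {linear cokernel g -> cokernel g'} :=
  HB.pack cokernel_map (GRing.isLinear.Build K (cokernel g) (cokernel g') _
    cokernel_map cokernel_map_is_linear).
End InducedMaps.
Arguments kernel_map {K V W V' W' g g' hV hW} hgg' v.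
Arguments cokernel_lin {K V W V' W' g g' hV hW} hgg'.
Arguments cokernel_map_pi {K V W V' W' g g' hV hW} hgg' w.

Section DirectSum.
Variables (K : fieldType) (A : choiceType) (V : A -> lmodType K).

Definition dprod : Type := forall a, V a.
HB.instance Definition _ := gen_eqMixin dprod.
HB.instance Definition _ := gen_choiceMixin dprod.

Definition dprod0 : dprod := fun=> 0.
Definition dprodN (u : dprod) : dprod := fun a => - u a.
Definition dprodD (u v : dprod) : dprod := fun a => u a + v a.
Definition dprodZ (k : K) (u : dprod) : dprod := fun a => k *: u a.

Fact dprod_addA : associative dprodD.
Proof. by move=> u v w; apply: functional_extensionality_dep => a; exact: addrA. Qed.
Fact dprod_addC : commutative dprodD.
Proof. by move=> u v; apply: functional_extensionality_dep => a; exact: addrC. Qed.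
Fact dprod_add0 : left_id dprod0 dprodD.
Proof. by move=> u; apply: functional_extensionality_dep => a; exact: add0r. Qed.
Fact dprod_addN : left_inverse dprod0 dprodN dprodD.
Proof. by move=> u; apply: functional_extensionality_dep => a; exact: addNr. Qed.
HB.instance Definition _ :=
  GRing.isZmodule.Build dprod dprod_addA dprod_addC dprod_add0 dprod_addN.

Fact dprod_scaleA k l u : dprodZ k (dprodZ l u) = dprodZ (k * l) u.
Proof. by apply: functional_extensionality_dep => a; exact: scalerA. Qed.
Fact dprod_scale1 : left_id 1 dprodZ.
Proof. by move=> u; apply: functional_extensionality_dep => a; exact: scale1r. Qed.
Fact dprod_scaleDr : right_distributive dprodZ +%R.
Proof. by move=> k u v; apply: functional_extensionality_dep => a; exact: scalerDr. Qed.
Fact dprod_scaleDl u : {morph dprodZ^~ u : k l / k + l}.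
Proof. by move=> k l; apply: functional_extensionality_dep => a; exact: scalerDl. Qed.
HB.instance Definition _ := GRing.Zmodule_isLmodule.Build K dprod
  dprod_scaleA dprod_scale1 dprod_scaleDr dprod_scaleDl.

Definition finsupp_pred : {pred dprod} :=
  [pred u | `[< finite_set [set a | u a != 0] >]].

Lemma finsupp_predP (u : dprod) :
  reflect (finite_set [set a | u a != 0]) (u \in finsupp_pred).
Proof. exact: asboolP. Qed.

Lemma finsupp_submod : submod_closed finsupp_pred.
Proof.
split=> [|k u v].
  by apply/finsupp_predP; apply: (sub_finite_set _ (finite_set0 A)) => a /=; rewrite eqxx.
move=> /finsupp_predP fu /finsupp_predP fv; apply/finsupp_predP.
apply: (sub_finite_set (B := [set a | u a != 0] `|` [set a | v a != 0])).
  move=> a /= kuv0; apply/orP; apply: contraNT kuv0; rewrite negb_or !negbK.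
  move=> /andP[/eqP u0 /eqP v0]; have -> : (k *: u + v) a = k *: u a + v a by [].
  by rewrite u0 v0 scaler0 addr0.
by rewrite finite_setU.
Qed.
HB.instance Definition _ :=
  GRing.isSubmodClosed.Build K dprod finsupp_pred finsupp_submod.

Record dsum := Dsum { dsum_val : dprod; _ : dsum_val \in finsupp_pred }.
HB.instance Definition _ := [isSub for dsum_val].
HB.instance Definition _ := [Choice of dsum by <:].
HB.instance Definition _ := [SubChoice_isSubLmodule of dsum by <:].

Definition dsum_in_fun (a : A) (v : V a) : dprod := dfwith (fun b : A => 0 : V b) a v.

Fact dsum_in_subproof (a : A) (v : V a) : dsum_in_fun v \in finsupp_pred.
Proof.
apply/finsupp_predP; apply: sub_finite_set (finite_set1 a) => b /=.
move=> vb0; apply/eqP; apply: contra_neqT vb0 => ba.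
by rewrite /dsum_in_fun dfwithout // eq_sym.
Qed.
Definition dsum_in (a : A) (v : V a) : dsum := Dsum (dsum_in_subproof v).

Lemma dsum_in_is_linear a : linear (@dsum_in a).
Proof.
move=> k u v; apply: val_inj; apply: functional_extensionality_dep => b /=.
have -> : forall x y : dprod, (k *: x + y) b = k *: x b + y b by [].
rewrite /dsum_in_fun; have [ab|ab] := eqVneq a b; first by case: b / ab; rewrite !dfwithin.
by rewrite !dfwithout // scaler0 addr0.
Qed.
HB.instance Definition _ a :=
  GRing.isLinear.Build K (V a) dsum _ (@dsum_in a) (@dsum_in_is_linear a).
Definition dsum_in_lin a : {linear V a -> dsum} := @dsum_in a.
End DirectSum.

Section DirectSumMap.
Variables (K : fieldType) (A : choiceType) (V W : A -> lmodType K).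
Variable h : forall a, {linear V a -> W a}.

Fact dsum_map_subproof (u : dsum V) :
  ((fun a => h a (dsum_val u a)) : dprod W) \in finsupp_pred (V := W).
Proof.
case: u => u /= /finsupp_predP fu; apply/finsupp_predP; apply: sub_finite_set fu.
by move=> a /=; apply: contra_neq => ->; rewrite linear0.
Qed.
Definition dsum_map (u : dsum V) : dsum W := Dsum (dsum_map_subproof u).

Lemma dsum_map_is_linear : linear dsum_map.
Proof.
move=> k u v; apply: val_inj; apply: functional_extensionality_dep => a /=.
exact: linearP.
Qed.
HB.instance Definition _ := GRing.isLinear.Build K (dsum V) (dsum W) _
  dsum_map dsum_map_is_linear.
End DirectSumMap.

Section ProductMap.
Variables (K : fieldType) (V W V' W' : lmodType K).
Variables (h : {linear V -> V'}) (k : {linear W -> W'}).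

Definition prod_map (u : V * W) : V' * W' := (h u.1, k u.2).

Lemma prod_map_is_linear : linear prod_map.
Proof. by move=> a u v; congr pair; rewrite /= linearP. Qed.
HB.instance Definition _ := GRing.isLinear.Build K (V * W)%type (V' * W')%type _
  prod_map prod_map_is_linear.
End ProductMap.

Section Persistence.
Context {d : Order.disp_t} (T : porderType d) (K : fieldType).
Local Open Scope order_scope.

Record pmod := PMod {
  pobj :> T -> lmodType K;
  pmap : forall x y, x <= y -> {linear pobj x -> pobj y};
  pmap_id : forall x (v : pobj x), pmap (lexx x) v = v;
  pmap_comp : forall x y z (xy : x <= y) (yz : y <= z) (v : pobj x),
    pmap yz (pmap xy v) = pmap (le_trans xy yz) v }.

Record pmor (M N : pmod) := PMor {
  pcomp :> forall x, {linear M x -> N x};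
  pmor_nat : forall x y (xy : x <= y) (v : M x),
    pcomp y (pmap M xy v) = pmap N xy (pcomp x v) }.

Definition pmor_zero (M N : pmod) (f : pmor M N) : Prop :=
  forall x (v : M x), f x v = 0%R.

Section Compose.
Variables (M N L : pmod) (g : pmor N L) (f : pmor M N).

Fact pmor_comp_nat x y (xy : x <= y) (v : M x) :
  (g y \o f y) (pmap M xy v) = pmap L xy ((g x \o f x) v).
Proof. by rewrite /= !pmor_nat. Qed.
Definition pmor_comp : pmor M L :=
  @PMor M L (fun x => (g x \o f x : {linear _ -> _})) pmor_comp_nat.
End Compose.

Record piso (M N : pmod) := PIso {
  piso_fun :> pmor M N;
  piso_inv : pmor N M;
  piso_funK : forall x, cancel (piso_fun x) (piso_inv x);
  piso_invK : forall x, cancel (piso_inv x) (piso_fun x) }.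

Definition isomorphic (M N : pmod) : Prop := inhabited (piso M N).

Section KerCokerModules.
Variables (M N : pmod) (f : pmor M N).

Definition pker_map x y (xy : x <= y) :
    {linear kernel (f x) -> kernel (f y)} :=
  kernel_map (pmor_nat f xy).
Definition pcoker_map x y (xy : x <= y) :
    {linear cokernel (f x) -> cokernel (f y)} :=
  cokernel_lin (pmor_nat f xy).

Program Definition pker : pmod :=
  @PMod (fun x => kernel (f x)) pker_map _ _.
Next Obligation.
by move=> x v; apply: (@val_inj _ _ (kernel (f x))); rewrite /= pmap_id.
Qed.
Next Obligation.
by move=> x y z xy yz v; apply: (@val_inj _ _ (kernel (f z))); rewrite /= pmap_comp.
Qed.

Program Definition pcoker : pmod :=
  @PMod (fun x => cokernel (f x)) pcoker_map _ _.
Next Obligation.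
move=> x v; have [w ->] := coker_piP v.
by rewrite [LHS](cokernel_map_pi (pmor_nat f _)) pmap_id.
Qed.
Next Obligation.
move=> x y z xy yz v; have [w ->] := coker_piP v.
transitivity (pcoker_map yz (coker_pi (f y) (pmap N xy w))).
  by congr (pcoker_map yz _); exact: (cokernel_map_pi (pmor_nat f xy)).
rewrite [LHS](cokernel_map_pi (pmor_nat f yz)) pmap_comp.
by rewrite [RHS](cokernel_map_pi (pmor_nat f _)).
Qed.
End KerCokerModules.

Section BinarySum.
Variables M N : pmod.

Program Definition padd : pmod :=
  @PMod (fun x => (M x * N x)%type)
    (fun x y xy => prod_map (pmap M xy) (pmap N xy)) _ _.
Next Obligation. by move=> x [u v]; congr pair; exact: pmap_id. Qed.
Next Obligation. by move=> x y z xy yz v; congr pair; exact: pmap_comp. Qed.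

Definition pinl_fun x (u : M x) : padd x := (u, 0%R).
Definition pinr_fun x (v : N x) : padd x := (0%R, v).

Lemma pinl_is_linear x : linear (@pinl_fun x).
Proof. by move=> a u v; congr pair; rewrite /= scaler0 addr0. Qed.
HB.instance Definition _ x := GRing.isLinear.Build K (M x) (padd x) _
  (@pinl_fun x) (@pinl_is_linear x).
Lemma pinr_is_linear x : linear (@pinr_fun x).
Proof. by move=> a u v; congr pair; rewrite /= scaler0 addr0. Qed.
HB.instance Definition _ x := GRing.isLinear.Build K (N x) (padd x) _
  (@pinr_fun x) (@pinr_is_linear x).

Program Definition pinl : pmor M padd := @PMor M padd (@pinl_fun) _.
Next Obligation. by move=> x y xy v; congr pair; rewrite linear0. Qed.
Program Definition pinr : pmor N padd := @PMor N padd (@pinr_fun) _.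
Next Obligation. by move=> x y xy v; congr pair; rewrite linear0. Qed.
End BinarySum.

Section BigSum.
Variables (A : choiceType) (M : A -> pmod).

Program Definition pbigsum : pmod :=
  @PMod (fun x => dsum (fun a => M a x))
    (fun x y xy => dsum_map (fun a => pmap (M a) xy)) _ _.
Next Obligation.
move=> x v; apply: (@val_inj _ _ (dsum _)).
by apply: functional_extensionality_dep => a; exact: pmap_id.
Qed.
Next Obligation.
move=> x y z xy yz v; apply: (@val_inj _ _ (dsum _)).
by apply: functional_extensionality_dep => a; exact: pmap_comp.
Qed.

Program Definition pbigsum_in a : pmor (M a) pbigsum :=
  @PMor (M a) pbigsum 
    (fun x => @dsum_in_lin K A (M^~ x) a) _.
Next Obligation.
move=> a x y xy v; apply: (@val_inj _ _ (dsum _)).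
apply: functional_extensionality_dep => b /=.
rewrite /dsum_in_fun; have [ab|ab] := eqVneq a b.
  by case: b / ab; rewrite !dfwithin.
by rewrite !dfwithout // linear0.
Qed.
End BigSum.

Definition order_convex (S : set T) : Prop :=
  forall x y z, S x -> S z -> x <= y -> y <= z -> S y.

Record convexSubset := ConvexSubset {
  cset :> set T;
  cset_convex : order_convex cset }.

Record posetInterval := PosetInterval {
  ival :> convexSubset;
  ival_nonempty : (ival : set T) !=set0 }.

(* The value at x is cut out of K as a subspace: the condition on k is void
   when x lies in S, and forces k = 0 otherwise. *)
Definition fiber_pred (S : set T) (x : T) : {pred K^o} :=
  [pred k | (k != 0%R) ==> `[< S x >]].

Lemma fiber_submod S x : submod_closed (fiber_pred S x).
Proof.
split=> [|a u v]; rewrite !inE ?eqxx // => uS vS; apply/implyP.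
apply: contraNT => xS; move: uS vS; rewrite (negbTE xS) !implybF !negbK.
by move=> /eqP-> /eqP->; rewrite scaler0 addr0.
Qed.
HB.instance Definition _ S x :=
  GRing.isSubmodClosed.Build K K^o (fiber_pred S x) (fiber_submod S x).

Record fiber (S : set T) (x : T) :=
  Fiber { fiber_val : K^o; _ : fiber_val \in fiber_pred S x }.
HB.instance Definition _ S x := [isSub for @fiber_val S x].
HB.instance Definition _ S x := [Choice of fiber S x by <:].
HB.instance Definition _ S x := [SubChoice_isSubLmodule of fiber S x by <:].

Fact fiber_map_subproof S x y (u : fiber S x) :
  (if `[< S y >] then fiber_val u else 0%R) \in fiber_pred S y.
Proof. by rewrite inE; case: ifP => _; rewrite ?eqxx ?implybT. Qed.

(* As the source is 0 when x is not in S, this is the identity of K if x and y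
   both lie in S, and 0 otherwise. *)
Definition fiber_map S x y (u : fiber S x) : fiber S y :=
  Fiber (fiber_map_subproof y u).

Lemma fiber_map_is_linear S x y : linear (@fiber_map S x y).
Proof.
move=> a u v; apply: val_inj => /=.
by case: ifP => _; rewrite ?linearP // scaler0 addr0.
Qed.
HB.instance Definition _ S x y := GRing.isLinear.Build K (fiber S x) (fiber S y) _
  (@fiber_map S x y) (@fiber_map_is_linear S x y).

Program Definition imod (S : convexSubset) : pmod :=
  @PMod (fiber S) (fun x y _ => @fiber_map S x y) _ _.
Next Obligation.
move=> S x [v vS]; apply: (@val_inj _ _ (fiber S x)) => /=; move: vS; rewrite inE.
by case: ifP => //= _; rewrite implybF negbK => /eqP.
Qed.
Next Obligation.
move=> S x y z xy yz [v vS]; apply: (@val_inj _ _ (fiber S z)) => /=.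
case: ifPn => //= /asboolP Sz.
case: ifPn => // /asboolP nSy; move: vS; rewrite inE.
have [//|v0 /= /asboolP Sx] := eqVneq v 0%R.
by case: nSy; exact: (cset_convex Sx Sz).
Qed.

Definition interval_decomposable (M : pmod) : Prop :=
  exists (A : choiceType) (S : A -> posetInterval),
    isomorphic M (pbigsum (fun a => imod (S a))).

Definition interval_le (I J : set T) : Prop :=
  (forall i, I i -> exists2 j, J j & i <= j) /\
  (forall j, J j -> exists2 i, I i & i <= j).

Definition interval_Supset (J I : set T) : Prop :=
  I `<=` J /\ exists a b, [/\ J a, J b & forall i, I i -> a < i < b].
End Persistence.

Arguments imod {d T} K S.

Notation "M ≅ N" := (isomorphic M N) (at level 70, no associativity).
Notation "M ⊕ N" := (padd M N) (at level 50, left associativity).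
Notation "g '\oP' f" := (pmor_comp g f) (at level 50, left associativity).
Notation "⨁_( a : A ) M" := (pbigsum (fun a : A => M))
  (at level 41, M at level 41, a at level 0,
   format "'[' ⨁_( a  :  A ) '/  '  M ']'").

Definition subposet {d : Order.disp_t} {T : orderType d} (P : set T) : Type :=
  set_type P.
HB.instance Definition _ d (T : orderType d) (P : set T) :=
  SubChoice.copy (subposet P) {x : T | x \in P}.
HB.instance Definition _ d (T : orderType d) (P : set T) :=
  [SubChoice_isSubOrder of subposet P by <: with d].

Lemma subposet_leE d (T : orderType d) (P : set T) (x y : subposet P) :
  (x <= y)%O = (val x <= val y)%O.
Proof. by []. Qed.

(* Main.v *)
(** A nonzero map from an interval module S to I is a nonzero scalar times the
    identity of K on S `&` I, and it exists only if I <= S; so f is given by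
    one scalar per summand S_b of M.  If infinitely many scalars are nonzero,
    no change of basis is needed.  Otherwise, whenever S_a <= S_b, subtracting
    from S_b a multiple of its image in S_a puts S_b in the kernel.  Two
    intervals that are incomparable for <= are strictly nested, hence the
    summands that survive form a chain, which we rescale so that f is the sum
    of the coordinates on I.  The kernel of this sum is described by the
    partial sums of the coordinates. *)

From HB Require Import structures.
From mathcomp Require Import all_boot all_order all_algebra.
From mathcomp Require Import all_classical all_reals.
Require Import Defs.

Set Implicit Arguments.
Unset Strict Implicit.
Unset Printing Implicit Defensive.

Import Order.TTheory GRing.Theory Num.Theory.
Local Open Scope classical_set_scope.
Local Open Scope ring_scope.

(** A summand can be eliminated only if a kept one lies below it for [interval_le]. A finite family
    can be thinned to a chain with this property. An infinite family may descend without end, but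
    there only the union of the supports matters, and keeping every summand with nonzero scalar
    preserves it. The kernel formula comes from asking where e_j - e_(j+1) makes sense. Inside [I]
    both terms must be present for their sum to vanish, so the points of [I] lying in M_j but not in
    M_(j+1) are removed from M_j. Outside [I] the target is zero, and e_j alone is a kernel element.
    M_n minus [I] is the case of an empty successor. That these sets are convex, and that the
    differences commute with the structure maps, rests on I <= M_j and on M_j meeting [I], for every
    j. *)

Section DirectSumUniversal.

(** * Universal property of direct sums of vector spaces *)

Variables (K : fieldType) (A : choiceType) (V : A -> lmodType K).

Lemma dsum_valP (u v : dsum V) :
  (forall a, dsum_val u a = dsum_val v a) -> u = v.
Proof. by move=> uv; apply/val_inj/functional_extensionality_dep. Qed.

Lemma dsum_val_lin k (u v : dsum V) a :
  dsum_val (k *: u + v) a = k *: dsum_val u a + dsum_val v a.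
Proof. by []. Qed.

Lemma dsum_val_sum (I : Type) (s : seq I) (F : I -> dsum V) a :
  dsum_val (\sum_(i <- s) F i) a = \sum_(i <- s) dsum_val (F i) a.
Proof. by elim/big_rec2: _ => // i x y _ <-. Qed.

Lemma dsum_val_in a (v : V a) : dsum_val (dsum_in v) a = v.
Proof. by rewrite /= /dsum_in_fun dfwithin. Qed.

Lemma dsum_val_in_neq a b (v : V a) : a != b -> dsum_val (dsum_in v) b = 0.
Proof. by move=> ab; rewrite /= /dsum_in_fun dfwithout. Qed.

Lemma dsum_finite (u : dsum V) : finite_set [set a | dsum_val u a != 0].
Proof. by case: u => u /= /finsupp_predP. Qed.

Definition dsum_supp (u : dsum V) : seq A :=
  finmap.enum_fset (fset_set [set a | dsum_val u a != 0]).

Lemma dsum_suppP (u : dsum V) a : (a \in dsum_supp u) = (dsum_val u a != 0).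
Proof.
rewrite /dsum_supp in_fset_set; last exact: dsum_finite.
by apply/idP/idP; rewrite inE.
Qed.

Lemma dsum_decomp (u : dsum V) (s : seq A) : uniq s ->
    {subset dsum_supp u <= s} ->
  u = \sum_(a <- s) dsum_in (dsum_val u a).
Proof.
move=> us su; apply: dsum_valP => b; rewrite dsum_val_sum.
have [bs|bs] := boolP (b \in s).
  rewrite (bigD1_seq b) //= big1 ?addr0; last first.
    by move=> a ab; exact: dsum_val_in_neq.
  exact/esym/dsum_val_in.
rewrite big_seq big1 => [|a aS].
  by apply/eqP; apply: contraNT bs => ub; rewrite su // dsum_suppP.
by apply: dsum_val_in_neq; apply: contraNneq bs => <-.
Qed.

Variable W : lmodType K.

Lemma dsum_ext (g h : {linear dsum V -> W}) :
  (forall a (v : V a), g (dsum_in v) = h (dsum_in v)) -> g =1 h.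
Proof.
move=> gh u; rewrite (@dsum_decomp u (dsum_supp u)) ?finmap.fset_uniq //.
by rewrite !linear_sum; apply: eq_bigr => a _; exact: gh.
Qed.

Variable h : forall a, {linear V a -> W}.

Definition dsum_case_fun (u : dsum V) : W :=
  \sum_(a <- dsum_supp u) h a (dsum_val u a).

(** The support of [k *: u + v] can be smaller than the union of the supports of [u] and [v];
    linearity therefore needs all three sums over one common list. *)
Lemma dsum_caseE (u : dsum V) (s : seq A) : uniq s ->
    {subset dsum_supp u <= s} ->
  dsum_case_fun u = \sum_(a <- s) h a (dsum_val u a).
Proof.
move=> us su; rewrite [RHS](bigID (mem (dsum_supp u))) /=.
rewrite [X in _ + X]big1 ?addr0 => [|a]; last first.
  by rewrite dsum_suppP negbK => /eqP->; rewrite linear0.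
rewrite -big_filter; apply: perm_big; apply: uniq_perm; rewrite ?finmap.fset_uniq //.
  exact: filter_uniq.
by move=> a; rewrite mem_filter; case: (boolP (a \in _)) => //= /su ->.
Qed.

Fact dsum_case_is_linear : linear dsum_case_fun.
Proof.
move=> k u v.
pose s := undup (dsum_supp u ++ dsum_supp v).
have us : uniq s by exact: undup_uniq.
rewrite (@dsum_caseE u s) ?(@dsum_caseE v s) ?(@dsum_caseE (k *: u + v) s) //.
- rewrite scaler_sumr -big_split; apply: eq_bigr => a _.
  exact: (linearP (h a)).
- move=> a; rewrite mem_undup mem_cat !dsum_suppP dsum_val_lin.
  apply: contraNT; rewrite negb_or !negbK => /andP[/eqP-> /eqP->].
  by rewrite scaler0 addr0.
- by move=> a; rewrite mem_undup mem_cat => ->; rewrite orbT.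
- by move=> a; rewrite mem_undup mem_cat => ->.
Qed.

HB.instance Definition _ :=
  GRing.isLinear.Build K (dsum V) W _ dsum_case_fun dsum_case_is_linear.
Definition dsum_case : {linear dsum V -> W} := dsum_case_fun.

Lemma dsum_case_in a (v : V a) : dsum_case (dsum_in v) = h a v.
Proof.
rewrite [LHS](@dsum_caseE (dsum_in v) [:: a]) //.
  by rewrite big_seq1 dsum_val_in.
move=> b; rewrite dsum_suppP inE; apply: contraNT; rewrite eq_sym => ab.
by rewrite dsum_val_in_neq.
Qed.
End DirectSumUniversal.

(** * Morphisms of persistence modules and their sums *)

Section Persistence.
Context {d : Order.disp_t} (T : porderType d) (K : fieldType).
Implicit Types M N W : pmod T K.

Section Sub.
Variables (M N : pmod T K) (f g : pmor M N) (k : K).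
Fact pmor_sub_nat x y (xy : (x <= y)%O) (v : M x) :
  (f y \- g y) (pmap M xy v) = pmap N xy ((f x \- g x) v).
Proof. by rewrite /= !pmor_nat linearB. Qed.
Definition pmor_sub : pmor M N :=
  @PMor _ _ _ M N (fun x => (f x \- g x : {linear _ -> _})) pmor_sub_nat.
Fact pmor_scale_nat x y (xy : (x <= y)%O) (v : M x) :
  (k \*: f y) (pmap M xy v) = pmap N xy ((k \*: f x) v).
Proof. by rewrite /= !pmor_nat linearZ. Qed.
Definition pmor_scale : pmor M N :=
  @PMor _ _ _ M N (fun x => (k \*: f x : {linear _ -> _})) pmor_scale_nat.
End Sub.

Section Inverse.
Variables (M N : pmod T K) (f : pmor M N) (g : forall x, N x -> M x).
Hypotheses (fK : forall x, cancel (f x) (@g x)).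
Hypotheses (gK : forall x, cancel (@g x) (f x)).
Fact pinv_is_linear x : linear (@g x).
Proof. by move=> k u v; apply: (can_inj (@fK x)); rewrite linearP !gK. Qed.
Definition pinv_lin x : {linear N x -> M x} :=
  HB.pack (@g x) (GRing.isLinear.Build K (N x) (M x) _ (@g x) (@pinv_is_linear x)).
Fact pinv_nat x y (xy : (x <= y)%O) (v : N x) :
  pinv_lin y (pmap N xy v) = pmap M xy (pinv_lin x v).
Proof. by apply: (can_inj (@fK y)); rewrite pmor_nat /= !gK. Qed.
(** A pointwise inverse suffices: its linearity and naturality can be checked after applying the
    injective [f]. *)
Definition piso_of_cancel : piso M N := @PIso _ _ _ M N f (PMor pinv_nat) fK gK.
End Inverse.

Definition piso_sym M N (f : piso M N) : piso N M :=
  PIso (piso_invK f) (piso_funK f).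

Definition piso_id M : piso M M.
Proof.
pose idM := @PMor _ _ _ M M (fun=> idfun) (fun _ _ _ _ => erefl).
exact: (@PIso _ _ _ M M idM idM (fun _ _ => erefl) (fun _ _ => erefl)).
Defined.

Section IsoComp.
Variables (M N W : pmod T K) (g : piso N W) (f : piso M N).
Fact piso_compK x : cancel ((g \oP f) x) ((piso_inv f \oP piso_inv g) x).
Proof. by move=> v /=; rewrite !piso_funK. Qed.
Fact piso_compVK x : cancel ((piso_inv f \oP piso_inv g) x) ((g \oP f) x).
Proof. by move=> v /=; rewrite !piso_invK. Qed.
Definition piso_comp : piso M W := PIso piso_compK piso_compVK.
End IsoComp.

Section Case.
Variables (A : choiceType) (V : A -> pmod T K) (W : pmod T K).
Variable h : forall a, pmor (V a) W.
Fact pbigsum_case_nat x y (xy : (x <= y)%O) (v : pbigsum V x) :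
  dsum_case (fun a => h a y) (pmap (pbigsum V) xy v) =
  pmap W xy (dsum_case (fun a => h a x) v).
Proof.
apply: (@dsum_ext _ _ _ _ (dsum_case (fun a => h a y) \o pmap (pbigsum V) xy)
  (pmap W xy \o dsum_case (fun a => h a x))) => a {}v /=.
rewrite dsum_case_in -(pmor_nat (h a)) -(dsum_case_in (fun a => h a y)).
by rewrite [X in dsum_case _ X = _](esym (pmor_nat (pbigsum_in V a) xy v)).
Qed.
Definition pbigsum_case : pmor (pbigsum V) W := PMor pbigsum_case_nat.
End Case.

Lemma pmor_compE M N W (g : pmor N W) (f : pmor M N) x (v : M x) :
  (g \oP f) x v = g x (f x v).
Proof. by []. Qed.

Lemma pmor_scaleE M N (f : pmor M N) k x (v : M x) :
  pmor_scale f k x v = k *: f x v.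
Proof. by []. Qed.

Lemma pbigsum_ext (A : choiceType) (V : A -> pmod T K) W
    (f g : pmor (pbigsum V) W) x :
    (forall a (v : V a x), f x (pbigsum_in V a x v) = g x (pbigsum_in V a x v)) ->
  f x =1 g x.
Proof. by move=> fg; apply: dsum_ext => a v; exact: fg. Qed.

Section AddCase.
Variables (M N W : pmod T K) (f : pmor M W) (g : pmor N W).
Definition padd_case_fun x (u : padd M N x) : W x := f x u.1 + g x u.2.
Fact padd_case_is_linear x : linear (@padd_case_fun x).
Proof. by move=> k u v; rewrite /padd_case_fun !linearP scalerDr addrACA. Qed.
HB.instance Definition _ x := GRing.isLinear.Build K (padd M N x) (W x) _
  (@padd_case_fun x) (@padd_case_is_linear x).
Fact padd_case_nat x y (xy : (x <= y)%O) (v : padd M N x) :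
  padd_case_fun (pmap (padd M N) xy v) = pmap W xy (padd_case_fun v).
Proof. by rewrite /padd_case_fun linearD -!pmor_nat. Qed.
Definition padd_case : pmor (padd M N) W :=
  @PMor _ _ _ (padd M N) W (fun x => (@padd_case_fun x : {linear _ -> _})) padd_case_nat.
End AddCase.

End Persistence.

(** * Canonical maps between interval modules *)

Section Fibers.
Context {d : Order.disp_t} (T : porderType d) (K : fieldType).
Implicit Types (S : set T) (x : T).

Lemma fiber_val_inj S x (u v : fiber K S x) : fiber_val u = fiber_val v -> u = v.
Proof. exact: val_inj. Qed.

Lemma fiber_valZ S x k (u : fiber K S x) : fiber_val (k *: u) = k * fiber_val u.
Proof. by []. Qed.

Lemma fiber_in S x (u : fiber K S x) : fiber_val u != 0 -> S x.
Proof. by case: u => u /=; rewrite inE => uS u0; apply/asboolP; rewrite u0 in uS. Qed.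

Lemma fiber_out S x (u : fiber K S x) : ~ S x -> fiber_val u = 0.
Proof. by move=> nS; apply/eqP; apply: contra_notT nS; exact: fiber_in. Qed.

Fact fiber_mk_subproof S x (k : K) :
  (if `[< S x >] then k else 0) \in @fiber_pred d T K S x.
Proof. by rewrite inE; case: ifP => _; rewrite ?eqxx ?implybT. Qed.
Definition fiber_mk S x (k : K) : fiber K S x := Fiber (fiber_mk_subproof S x k).

Lemma fiber_mk_in S x k : S x -> fiber_val (fiber_mk S x k) = k.
Proof. by move=> Sx /=; case: asboolP. Qed.

Lemma fiber_mk_is_linear S x : linear (fiber_mk S x : K^o -> fiber K S x).
Proof.
move=> k u v; apply: fiber_val_inj => /=.
by case: asboolP => // _; rewrite scaler0 addr0.
Qed.

Definition fiber_can S S' x (u : fiber K S x) : fiber K S' x :=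
  fiber_mk S' x (fiber_val u).
Lemma fiber_can_is_linear S S' x : linear (@fiber_can S S' x).
Proof. by move=> k u v; rewrite -fiber_mk_is_linear. Qed.
HB.instance Definition _ S S' x := GRing.isLinear.Build K (fiber K S x)
  (fiber K S' x) _ (@fiber_can S S' x) (@fiber_can_is_linear S S' x).

(* The condition under which the identity of K on the points of S `&` S',
   extended by 0, commutes with the structure maps. *)
Definition can_nat S S' : Prop :=
  forall x y, (x <= y)%O -> S x -> S' y -> (S' x <-> S y).

Section CanonicalMap.
Variables (S S' : convexSubset T) (SS' : can_nat S S').
Fact imod_can_nat x y (xy : (x <= y)%O) (v : imod K S x) :
  fiber_can S' (pmap (imod K S) xy v) = pmap (imod K S') xy (fiber_can S' v).
Proof.
apply: fiber_val_inj => /=; case: asboolP => // S'y.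
have [v0|/fiber_in Sx] := eqVneq (fiber_val v) 0; first by rewrite v0 !if_same.
by have := SS' xy Sx S'y; do 2 case: asboolP => //; tauto.
Qed.
Definition imod_can : pmor (imod K S) (imod K S') :=
  @PMor _ _ _ (imod K S) (imod K S') (fun x => (@fiber_can S S' x : {linear _ -> _}))
    imod_can_nat.
End CanonicalMap.

(** Both sides of the equivalence hold: a point of [S] above [y] and a point of [S'] below [x] put
    [y] in [S] and [x] in [S'] by convexity. *)
Lemma interval_le_can_nat (S S' : convexSubset T) :
  interval_le S' S -> can_nat S S'.
Proof.
move=> [le1 le2] x y xy Sx S'y; split=> _.
  by have [z Sz yz] := le1 _ S'y; exact: (cset_convex Sx Sz xy yz).
by have [z S'z zx] := le2 _ Sx; exact: (cset_convex S'z S'y zx xy).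
Qed.

Lemma interval_le_refl S : interval_le S S.
Proof. by split=> x Sx; exists x. Qed.

Lemma interval_le_trans S S' S'' :
  interval_le S S' -> interval_le S' S'' -> interval_le S S''.
Proof.
move=> [a b] [a' b']; split=> x.
  move=> /a[y /a'[z Sz yz] xy]; exists z => //; exact: le_trans xy yz.
move=> /b'[y /b[z Sz yz] xy]; exists z => //; exact: le_trans yz xy.
Qed.

(** * Cokernel of a map into an interval module *)

Section Cokernel.
Variables (M : pmod T K) (I : convexSubset T) (f : pmor M (imod K I)) (U : set T).
Hypothesis UP : forall x, (I : set T) x -> (U x <-> exists v, fiber_val (f x v) != 0).

(** Structure maps between points of [I] are identities, so a nonzero value of [f] persists upward.
    The image thus lives on an up-set of [I], whose complement in [I] is convex. *)
Lemma coker_support_up x y : (x <= y)%O -> (I : set T) x -> (I : set T) y -> U x -> U y.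
Proof.
move=> xy Ix Iy /UP -/(_ Ix)[v fv]; apply/UP => //.
exists (pmap M xy v); rewrite pmor_nat /=.
by case: asboolP.
Qed.

Lemma coker_support_convex : order_convex (I `\` U).
Proof.
move=> x y z [Ix nUx] [Iz nUz] xy yz.
have Iy : (I : set T) y by exact: cset_convex Ix Iz xy yz.
by split=> // Uy; apply: nUz; exact: coker_support_up Uy.
Qed.

(** Either the fiber of [I] is zero, or it is one-dimensional and a nonzero value of [f] spans
    it. *)
Lemma coker_pi_eq0_out x (w : imod K I x) : ~ (I `\` U) x -> coker_pi (f x) w = 0.
Proof.
move=> nx; apply/coker_pi_eq0.
have [w0|w0] := eqVneq (fiber_val w) 0.
  by exists 0; rewrite linear0; apply: fiber_val_inj; rewrite w0.
have Ix := fiber_in w0.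
have /UP -/(_ Ix)[v fv] : U x by apply: contrapT => nU; apply: nx.
exists ((fiber_val w / fiber_val (f x v)) *: v).
by rewrite linearZ; apply: fiber_val_inj => /=; rewrite [LHS]divfK.
Qed.

Lemma coker_map0 x (v : M x) : (I `\` U) x -> f x v = 0.
Proof.
move=> [Ix nU]; apply: fiber_val_inj; apply/eqP; apply: contra_notT nU => fv.
by apply/UP => //; exists v.
Qed.

Let J := ConvexSubset coker_support_convex.

Fact coker_imod_nat x y (xy : (x <= y)%O) (v : imod K J x) :
  coker_pi (f y) (fiber_can I (pmap (imod K J) xy v)) =
  pmap (pcoker f) xy (coker_pi (f x) (fiber_can I v)).
Proof.
rewrite [RHS](cokernel_map_pi (pmor_nat f xy)).
have [Jy|nJ] := pselect ((I `\` U) y); last by rewrite !coker_pi_eq0_out.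
congr coker_pi; apply: fiber_val_inj => /=.
case: (asboolP ((I : set T) y)) => // Iy; case: (asboolP ((I `\` U) y)) => // _.
case: asboolP => // nI; rewrite fiber_out // => -[]//.
Qed.
Definition coker_imod : pmor (imod K J) (pcoker f) :=
  @PMor _ _ _ (imod K J) (pcoker f)
    (fun x => (coker_pi (f x) \o @fiber_can J I x : {linear _ -> _})) coker_imod_nat.

Lemma pcoker_imod : exists cvx : order_convex (I `\` U),
  pcoker f ≅ imod K (ConvexSubset cvx).
Proof.
exists coker_support_convex; constructor; apply: piso_sym.
(* On [I] minus [U] the map [f] vanishes, so a class has only one representative; elsewhere the
   quotient is zero. The choice made by [repr] is therefore harmless. *)
apply: (@piso_of_cancel _ _ _ _ _ coker_imod
  (fun x (q : pcoker f x) => fiber_can (S:=I) J (repr q))).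
- move=> x v; apply: fiber_val_inj => /=.
  case: asboolP => [Jx|nJ]; last by rewrite fiber_out.
  have [u wE _] := coker_repr (f x) (fiber_can I v).
  move/(congr1 (@fiber_val _ _ _ _ _)): wE; rewrite coker_map0 // addr0 /=.
  by case: Jx => Ix _; case: asboolP => // _ ->.
- move=> x q /=; have [Jx|nJ] := pselect ((I `\` U) x).
    rewrite -[RHS]reprK; congr coker_pi; apply: fiber_val_inj => /=.
    by case: Jx => Ix nU; do 2![case: asboolP => //=]; case; split.
  by have [w ->] := coker_piP q; rewrite !coker_pi_eq0_out.
Qed.
End Cokernel.

(** * Recognizing a kernel from an explicit parametrization *)

Section Kernel.
Variables (M N W : pmod T K) (f : pmor M W) (p : pmor N M) (g : forall x, M x -> N x).
Hypothesis fp : forall x (v : N x), f x (p x v) = 0.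
Hypothesis gp : forall x, cancel (p x) (@g x).
Hypothesis pg : forall x (u : M x), f x u = 0 -> p x (g u) = u.

Fact pker_lift_subproof x (v : N x) : p x v \in kernel_pred (f x).
Proof. by rewrite inE fp. Qed.
Definition pker_lift_fun x (v : N x) : pker f x := Kernel (pker_lift_subproof v).
Fact pker_lift_is_linear x : linear (@pker_lift_fun x).
Proof. by move=> k u v; apply: (@val_inj _ _ (kernel (f x))); rewrite /= linearP. Qed.
HB.instance Definition _ x := GRing.isLinear.Build K (N x) (pker f x) _
  (@pker_lift_fun x) (@pker_lift_is_linear x).
Fact pker_lift_nat x y (xy : (x <= y)%O) (v : N x) :
  pker_lift_fun (pmap N xy v) = pmap (pker f) xy (pker_lift_fun v).
Proof. by apply: (@val_inj _ _ (kernel (f y))); rewrite /= pmor_nat. Qed.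
Definition pker_lift : pmor N (pker f) :=
  @PMor _ _ _ N (pker f) (fun x => (@pker_lift_fun x : {linear _ -> _})) pker_lift_nat.

Lemma pker_iso : pker f ≅ N.
Proof.
constructor; apply: piso_sym.
apply: (@piso_of_cancel _ _ _ _ _ pker_lift
  (fun x (u : pker f x) => g (kernel_val u))) => x u /=; first exact: gp.
apply: (@val_inj _ _ (kernel (f x))) => /=; apply: pg.
by case: u => u /=; rewrite inE => /eqP.
Qed.
End Kernel.
End Fibers.

(** * Change of basis in a direct sum *)

(* The summands indexed by the image of iota are rescaled by c^-1; each other
   summand is replaced by its image under the difference of its inclusion and a
   correction term in the summands indexed by iota. *)
Section Splitting.
Context {d : Order.disp_t} (T : porderType d) (K : fieldType).
Variables (A B : choiceType) (V : B -> pmod T K) (iota : A -> B).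
Hypothesis iota_inj : injective iota.

(** The condition is a boolean, so its proofs are unique and two indices over the same [b] agree;
    [split_fwd_at_outside] relies on this. *)
Definition outside : Type := {b : B | `[< forall a, iota a != b >]}.
HB.instance Definition _ := Choice.on outside.
Definition outside_val (c : outside) : B := sval c.

Variables (c : A -> K) (corr : forall e : outside,
  pmor (V (outside_val e)) (⨁_(a : A) V (iota a))).
Hypothesis c0 : forall a, c a != 0.

Let N : pmod T K := ⨁_(e : outside) V (outside_val e).
Let M' : pmod T K := ⨁_(a : A) V (iota a).
Let M : pmod T K := ⨁_(b : B) V b.

Definition split_incl : pmor M' M :=
  pbigsum_case (fun a => pmor_scale (pbigsum_in V (iota a)) (c a)^-1).
Definition split_bwd : pmor (N ⊕ M') M :=
  padd_case (pbigsum_case (fun e =>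
    pmor_sub (pbigsum_in V (outside_val e)) (split_incl \oP corr e))) split_incl.

Lemma split_bwd_inr x (w : M' x) : split_bwd x (pinr N M' x w) = split_incl x w.
Proof. by rewrite /= /padd_case_fun /= linear0 add0r. Qed.

Lemma split_bwd_inl x (e : outside) (v : V (outside_val e) x) :
  split_bwd x (pinl N M' x (pbigsum_in (fun e => V (outside_val e)) e x v)) =
  pbigsum_in V (outside_val e) x v - split_incl x (corr e x v).
Proof. by rewrite /= /padd_case_fun /= linear0 addr0 dsum_case_in. Qed.

Lemma split_incl_in x a (v : V (iota a) x) :
  split_incl x (pbigsum_in (fun a => V (iota a)) a x v) =
  (c a)^-1 *: pbigsum_in V (iota a) x v.
Proof. by rewrite /= dsum_case_in. Qed.

(** It lives in [Type] and carries a chosen preimage because a morphism is built by cases on it. *)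
Variant inside_spec (b : B) : Type :=
| Inside a of iota a = b
| Outside of `[< forall a, iota a != b >].

Lemma insideP b : inside_spec b.
Proof.
have [h|/existsNP h] := pselect (forall a, iota a != b).
  by apply/Outside/asboolP.
by have [a /negP/negPn/eqP] := cid h; exact: Inside.
Qed.

Section Pair.
Variables (L L1 L2 : pmod T K) (f : pmor L L1) (g : pmor L L2).
Definition ppair_fun x (v : L x) : (L1 ⊕ L2) x := (f x v, g x v).
Fact ppair_is_linear x : linear (@ppair_fun x).
Proof. by move=> k u v; rewrite /ppair_fun !linearP. Qed.
HB.instance Definition _ x := GRing.isLinear.Build K (L x) ((L1 ⊕ L2) x) _
  (@ppair_fun x) (@ppair_is_linear x).
Fact ppair_nat x y (xy : (x <= y)%O) (v : L x) :
  ppair_fun (pmap L xy v) = pmap (L1 ⊕ L2) xy (ppair_fun v).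
Proof. by rewrite /ppair_fun !pmor_nat. Qed.
Definition ppair : pmor L (L1 ⊕ L2) :=
  @PMor _ _ _ L (L1 ⊕ L2) (fun x => (@ppair_fun x : {linear _ -> _})) ppair_nat.
End Pair.

(** The inverse of [split_bwd] on one summand: a kept summand is scaled back by [c a], any other
    gets its correction added back in the second component. The cast transports along [iota a = b];
    injectivity of [iota] and uniqueness of equality proofs on [B] remove it later. *)
Definition split_fwd_at (b : B) : pmor (V b) (N ⊕ M') :=
  match insideP b with
  | Inside a e => ecast b (pmor (V b) (N ⊕ M')) e
      (pmor_scale (pinr N M' \oP pbigsum_in (fun a => V (iota a)) a) (c a))
  | Outside h => ppair (pbigsum_in (fun e : outside => V (outside_val e)) (exist _ b h))
      (corr (exist _ b h))
  end.
Definition split_fwd : pmor M (N ⊕ M') := pbigsum_case split_fwd_at.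

Lemma split_fwd_in x b (v : V b x) :
  split_fwd x (pbigsum_in V b x v) = split_fwd_at b x v.
Proof. exact: dsum_case_in. Qed.

Lemma split_fwd_at_iota x a (v : V (iota a) x) :
  split_fwd_at (iota a) x v =
  c a *: pinr N M' x (pbigsum_in (fun a => V (iota a)) a x v).
Proof.
rewrite /split_fwd_at; case: insideP => [a' e|/asboolP/(_ a)/eqP//].
have aa := iota_inj e; subst a'.
by rewrite (eq_irrelevance e erefl).
Qed.

Lemma split_fwd_at_outside x (e : outside) (v : V (outside_val e) x) :
  split_fwd_at (outside_val e) x v =
  pinl N M' x (pbigsum_in (fun e : outside => V (outside_val e)) e x v) +
  pinr N M' x (corr e x v).
Proof.
case: e v => b h v; rewrite /split_fwd_at; case: insideP => [a e|h'].
  by case/eqP: (asboolW h a).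
rewrite (bool_irrelevance h' h).
by congr pair; rewrite ?addr0 ?add0r.
Qed.

Lemma split_fwd_incl x (w : M' x) : split_fwd x (split_incl x w) = pinr N M' x w.
Proof.
apply: (pbigsum_ext (f := split_fwd \oP split_incl) (g := pinr N M')) => a v.
rewrite pmor_compE split_incl_in linearZZ split_fwd_in split_fwd_at_iota.
by rewrite scalerA mulVf // scale1r.
Qed.

Lemma split_bwdK x : cancel (split_bwd x) (split_fwd x).
Proof.
move=> [u w].
have -> : (u, w) = pinl N M' x u + pinr N M' x w :> (N ⊕ M') x.
  by congr pair; rewrite ?addr0 ?add0r.
rewrite (linearD (split_bwd x)) (linearD (split_fwd x)) split_bwd_inr split_fwd_incl.
congr (_ + _).
apply: (pbigsum_ext (f := split_fwd \oP (split_bwd \oP pinl N M')) (g := pinl N M')).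
move=> e v; rewrite !pmor_compE split_bwd_inl linearB split_fwd_incl split_fwd_in.
by rewrite split_fwd_at_outside addrK.
Qed.

Lemma split_fwdK x : cancel (split_fwd x) (split_bwd x).
Proof.
apply: (pbigsum_ext (f := split_bwd \oP split_fwd) (g := piso_id M)) => b v.
rewrite pmor_compE split_fwd_in.
case: (insideP b) => [a e|h].
  case: b / e in v *.
  rewrite split_fwd_at_iota linearZZ split_bwd_inr split_incl_in.
  by rewrite scalerA mulfV // scale1r.
have := @split_fwd_at_outside x (exist _ b h) v => /= ->.
by rewrite linearD split_bwd_inl split_bwd_inr subrK.
Qed.

Definition split_iso : piso M (N ⊕ M') := PIso split_fwdK split_bwdK.
End Splitting.

(** * Intervals of a total order: homomorphisms, comparison, chains *)

Section TotalOrder.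
Context {d : Order.disp_t} (T : orderType d) (K : fieldType).
Implicit Types S I : posetInterval T.

(** Fix [x] where [h] is nonzero. By totality every point compares with [x], and naturality along
    that comparison carries the scalar over. It also puts [I] above [x] inside [S], and [S] below
    [x] inside [I], whence the order relation. *)
Lemma imod_hom_coef S I (h : pmor (imod K S) (imod K I)) :
  exists2 c : K, forall x (v : imod K S x), fiber_val (h x v) =
      if `[< (I : set T) x >] then c * fiber_val v else 0 &
    c != 0 -> interval_le I S /\ (S : set T) `&` I !=set0.
Proof.
have [h0|/existsNP[x /existsNP[v hv]]] := pselect (pmor_zero h).
  by exists 0; rewrite ?eqxx // => x v; rewrite h0 mul0r if_same.
have hv0 : fiber_val (h x v) != 0.
  by apply: contra_notN hv => /eqP hv; apply: fiber_val_inj.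
have v0 : fiber_val v != 0.
  apply: contraNN hv0 => /eqP v0; rewrite (_ : v = 0) ?linear0 //.
  exact: fiber_val_inj.
have [Sx Ix] := (fiber_in v0, fiber_in hv0).
(* Otherwise [v] dies in [S] on the way to [y], while its nonzero image survives in [I]. *)
have up y : (x <= y)%O -> (I : set T) y -> (S : set T) y.
  move=> xy Iy; apply: contrapT => nS; move/eqP: hv0; apply.
  have /(congr1 (@fiber_val _ _ _ _ _)) := pmor_nat h xy v.
  rewrite (_ : pmap _ _ _ = 0); last first.
    by apply: fiber_val_inj => /=; case: asboolP.
  by rewrite linear0 /=; case: asboolP => // _ <-.
(* The element [w] is a lift of [v] to [y]; its image must map to [h x v], so it carries the same
   scalar. *)
have down y : (y <= x)%O -> (S : set T) y -> exists w : imod K S y,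
    fiber_val w = fiber_val v /\ fiber_val (h y w) = fiber_val (h x v).
  move=> yx Sy; exists (fiber_mk S y (fiber_val v : K)); rewrite fiber_mk_in //.
  split=> //; have /(congr1 (@fiber_val _ _ _ _ _)) :=
    pmor_nat h yx (fiber_mk S y (fiber_val v : K)).
  rewrite (_ : pmap _ _ _ = v); last first.
    by apply: fiber_val_inj => /=; do 2 case: asboolP => //.
  by move=> -> /=; case: asboolP.
exists (fiber_val (h x v) / fiber_val v).
  move=> y w; case: asboolP => [Iy|nI]; last by rewrite fiber_out.
  have [w0|w0] := eqVneq (fiber_val w) 0.
    rewrite w0 mulr0 (_ : w = 0) ?linear0 //; exact: fiber_val_inj.
  have Sy := fiber_in w0.
  (* The fiber at [y] has dimension at most one, so [w] is a multiple of any nonzero [u]. *)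
  have hscale (u : imod K S y) : fiber_val (h y w) =
      fiber_val w / fiber_val u * fiber_val (h y u) \/ fiber_val u = 0.
    have [->|u0] := eqVneq (fiber_val u) 0; [by right|left].
    rewrite (_ : w = (fiber_val w / fiber_val u) *: u) ?linearZZ //.
      by rewrite /= [X in _ = X / _ * _]divfK.
    by apply: fiber_val_inj => /=; rewrite [RHS]divfK.
  have [xy|yx] := leP x y.
    have [hw|] := hscale (pmap (imod K S) xy v); last first.
      by move=> /= /eqP; case: asboolP => // _; rewrite (negbTE v0).
    rewrite hw pmor_nat /=; do 2 case: asboolP => // _.
    by rewrite mulrC mulrA mulrAC.
  have [u [uv hu]] := down y (ltW yx) Sy.
  have [hw|] := hscale u; last by rewrite uv => /eqP; rewrite (negbTE v0).
  by rewrite hw hu uv mulrC mulrA mulrAC.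
move=> _; split; last by exists x.
split=> y.
  move=> Iy; have [xy|yx] := leP x y; first by exists y => //; exact: up.
  by exists x => //; exact: ltW.
move=> Sy; have [xy|yx] := leP x y; first by exists x.
have [u [_ hu]] := down y (ltW yx) Sy.
by exists y => //; apply: (fiber_in (u := h y u)); rewrite hu.
Qed.

Definition strict_over S S' : bool := `[< interval_Supset (S : set T) S' >].

Lemma interval_Supset_between S S' a b : (S : set T) a -> (S : set T) b ->
  (forall i, (S' : set T) i -> (a < i)%O /\ (i < b)%O) -> interval_Supset (S : set T) S'.
Proof.
move=> Sa Sb ab; split=> [i S'i|].
  by have [/ltW ai /ltW ib] := ab i S'i; exact: (cset_convex Sa Sb ai ib).
by exists a, b; split=> // i /ab[-> ->].
Qed.

Lemma interval_leN S S' : ~ interval_le (S : set T) S' ->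
  (exists2 i, (S : set T) i & forall j, (S' : set T) j -> (j < i)%O) \/
  (exists2 j, (S' : set T) j & forall i, (S : set T) i -> (j < i)%O).
Proof.
move=> /not_andP[/existsNP[i /not_implyP[Si ni]]|/existsNP[j /not_implyP[Sj nj]]].
  left; exists i => // j S'j; rewrite ltNge; apply/negP => ij; apply: ni.
  by exists j.
right; exists j => // i Si; rewrite ltNge; apply/negP => ij; apply: nj.
by exists i.
Qed.

(** Each failure of [interval_le] gives a point of one interval beyond all of the other. Two points
    beyond on the same side contradict each other, so one interval has points on both sides of the
    other. *)
Lemma interval_dichotomy S S' :
  [\/ interval_le (S : set T) S', interval_le (S' : set T) S,
      strict_over S S' | strict_over S' S].
Proof.
have [?|/interval_leN h] := pselect (interval_le (S : set T) S').
  exact: Or41.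
have [?|/interval_leN h'] := pselect (interval_le (S' : set T) S).
  exact: Or42.
case: h => -[i Si iS']; case: h' => -[j Sj jS].
- by have := lt_trans (iS' _ Sj) (jS _ Si); rewrite ltxx.
- by apply/Or43/asboolP; apply: interval_Supset_between Sj Si _ => k S'k; split; auto.
- by apply/Or44/asboolP; apply: interval_Supset_between Si Sj _ => k S'k; split; auto.
- by have := lt_trans (iS' _ Sj) (jS _ Si); rewrite ltxx.
Qed.

Lemma strict_over_irr S : strict_over S S = false.
Proof.
by apply/asboolP => -[_ [a [b [Sa _ /(_ a Sa)]]]]; rewrite ltxx.
Qed.

Lemma strict_over_trans S S' S'' :
  strict_over S S' -> strict_over S' S'' -> strict_over S S''.
Proof.
move=> /asboolP[sub [a [b [Sa Sb ab]]]] /asboolP[sub' _]; apply/asboolP.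
split; first exact: subset_trans sub' sub.
by exists a, b; split=> // i /sub'/ab.
Qed.

Section Chain.
Variables (B : eqType) (S : B -> posetInterval T).
Let over a b := strict_over (S a) (S b).

(** The new [b] moves inward past the intervals strictly over it and deletes those it precedes for
    [interval_le]. It is dropped if one precedes it, and settles in front of the first interval that
    it is strictly over. Whatever covers [b] covers the deleted intervals by transitivity. *)
Lemma chain_insert b s : pairwise over s -> exists s',
  [/\ {subset s' <= b :: s}, pairwise over s' &
      forall c, c \in b :: s -> exists2 a, a \in s' & interval_le (S a : set T) (S c)].
Proof.
elim: s => [_|a s IH /=/andP[aos pos]].
  exists [:: b]; split=> // c; rewrite inE => /eqP->.
  by exists b; rewrite ?inE //; exact: interval_le_refl.
have [ab|ba|ab|ba] := interval_dichotomy (S a) (S b).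
- exists (a :: s); split=> [c|/=|c].
  + by rewrite !inE => ->; rewrite orbT.
  + by rewrite aos.
  + rewrite inE => /predU1P[->|cs].
      by exists a; rewrite ?inE ?eqxx.
    by exists c => //; exact: interval_le_refl.
- have [s' [sub pw cov]] := IH pos; exists s'; split=> // c.
    by move=> /sub; rewrite !inE => /orP[->|->]; rewrite ?orbT.
  rewrite !inE => /or3P[/eqP->|/eqP->|cs].
  + by apply: cov; rewrite inE eqxx.
  + have [e es eb] := cov b (mem_head _ _).
    by exists e => //; exact: interval_le_trans ba.
  + by apply: cov; rewrite inE cs orbT.
- have [s' [sub pw cov]] := IH pos; exists (a :: s'); split=> [c|/=|c].
  + rewrite !inE => /predU1P[->|/sub]; first by rewrite eqxx orbT.
    by rewrite inE => /orP[->|->]; rewrite ?orbT.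
  + rewrite pw andbT; apply/allP => c /sub; rewrite inE => /predU1P[->//|cs].
    exact: (allP aos).
  + rewrite !inE => /or3P[/eqP->|/eqP->|cs].
    * by have [e es eb] := cov b (mem_head _ _); exists e; rewrite // inE es orbT.
    * by exists a; rewrite ?inE ?eqxx //; exact: interval_le_refl.
    * have [|e es ec] := cov c; first by rewrite inE cs orbT.
      by exists e; rewrite // inE es orbT.
- exists [:: b, a & s]; split=> //= [|c cs].
    rewrite /over ba aos pos /= andbT; apply/allP => c cs.
    by apply: strict_over_trans ba _; exact: (allP aos).
  by exists c => //; exact: interval_le_refl.
Qed.

Lemma chain_exists (s0 : seq B) : exists s,
  [/\ {subset s <= s0}, pairwise over s &
      forall c, c \in s0 -> exists2 a, a \in s & interval_le (S a : set T) (S c)].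
Proof.
elim: s0 => [|b s0 [s [sub pw cov]]]; first by exists [::].
have [s' [sub' pw' cov']] := chain_insert b pw.
exists s'; split=> // c.
  by move=> /sub'; rewrite !inE => /predU1P[->|/sub ->]; rewrite ?eqxx ?orbT.
rewrite inE => /predU1P[->|/cov[a as_ ac]]; first by apply: cov'; rewrite inE eqxx.
have [|e es ea] := cov' a; first by rewrite inE as_ orbT.
by exists e => //; exact: interval_le_trans ac.
Qed.
End Chain.
End TotalOrder.

(** * Kernel of the sum map on a nested chain *)

Section FiniteDirectSum.
Variables (K : fieldType) (A : finType) (V : A -> lmodType K).

Fact dsum_mk_subproof (w : forall a, V a) : (w : dprod V) \in finsupp_pred (V := V).
Proof. by apply/finsupp_predP; exact: finite_finset. Qed.
Definition dsum_mk (w : forall a, V a) : dsum V := Dsum (dsum_mk_subproof w).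
End FiniteDirectSum.

Section ChainKernel.
Context {d : Order.disp_t} (T : orderType d) (K : fieldType).
Variables (I : posetInterval T) (D : nat -> posetInterval T) (m : nat).
Hypothesis ID : forall j, (j <= m)%N ->
  interval_le (I : set T) (D j) /\ (D j : set T) `&` I !=set0.
Hypothesis DS : forall j, (j < m)%N -> (D j.+1 : set T) `<=` D j.

Let step j : set T := D j `\` ((D j `\` D j.+1) `&` I).
Let last : set T := D m `\` I.
(** One indexing for all kernel intervals: [last] is the formula of [step] at [m] with [D m.+1] read
    as empty. *)
Let L j : set T := if (j < m)%N then step j else if j == m then last else set0.

Lemma chain_sub i j x : (i <= j <= m)%N -> (D j : set T) x -> (D i : set T) x.
Proof.
elim: j => [|j IH]; first by rewrite leqn0 => /andP[/eqP->].
rewrite leq_eqVlt => /andP[/predU1P[->//|ij] jm] Dx.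
by apply: IH; [rewrite -ltnS ij ltnW | exact: DS].
Qed.

Lemma L_le j x : L j x -> (j <= m)%N.
Proof. by rewrite /L; case: ltngtP. Qed.

Lemma L_D j x : L j x -> (D j : set T) x.
Proof. by rewrite /L; case: ltngtP => // [_|->] []. Qed.

Lemma L_stepD j x : L j x -> (j < m)%N -> (I : set T) x -> (D j.+1 : set T) x.
Proof.
rewrite /L => + jm; rewrite jm => -[Dx nD] Ix.
by apply: contrapT => nDx; apply: nD; split.
Qed.

Lemma L_last x : L m x -> ~ (I : set T) x.
Proof. by rewrite /L ltnn eqxx => -[]. Qed.

Lemma D_down j x y : (j <= m)%N -> (D j : set T) x -> (x <= y)%O ->
  (I : set T) y -> (I : set T) x.
Proof.
move=> jm Dx xy Iy; have [[_ le2] _] := ID jm.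
by have [i Ii ix] := le2 _ Dx; exact: (cset_convex Ii Iy ix xy).
Qed.

(** The points removed from [D j] form a down-set of [D j]: if [y] is in [I], so is [x], hence [x]
    lies in [D j.+1] when [j < m], and [y] too because [D j.+1] has a point above it. Convexity of
    [L j] and naturality of [kmap] both rest on this. *)
Lemma L_up j x y : (x <= y)%O -> L j x -> (D j : set T) y -> L j y.
Proof.
move=> xy Lx Dy; have jm := L_le Lx; have Dx := L_D Lx.
move: (jm); rewrite leq_eqVlt => /predU1P[jE|jlt].
  subst j; rewrite /L ltnn eqxx; split=> // Iy.
  by apply: (L_last Lx); exact: (D_down jm Dx xy Iy).
rewrite /L jlt; split=> // -[[_ nD] Iy]; apply: nD.
have Ix : (I : set T) x by exact: (D_down jm Dx xy Iy).
have D'x := L_stepD Lx jlt Ix; have [[le1 _] _] := ID jlt.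
by have [z D'z yz] := le1 _ Iy; exact: (cset_convex D'x D'z xy yz).
Qed.

Lemma L_predI j x : (j < m)%N -> (D j.+1 : set T) x -> L j x.
Proof. by move=> jm Dx; rewrite /L jm; split; [exact: DS | move=> [[]]]. Qed.

(** If [x] is outside [I], it lies above a common point of [D j.+1] and [I], since a point of [D j]
    below a point of [I] is in [I]. Hence e_(j+1) cannot appear anew along a structure map. *)
Lemma L_next j x y : (x <= y)%O -> (j < m)%N -> L j x -> (D j.+1 : set T) y ->
  (D j.+1 : set T) x.
Proof.
move=> xy jm Lx Dy; have [Ix|nI] := pselect ((I : set T) x); first exact: L_stepD.
have [[_ _] [z [Dz Iz]]] := ID jm.
have [zx|/ltW xz] := leP z x; first exact: (cset_convex Dz Dy zx xy).
by case: nI; exact: (D_down (ltnW jm) (L_D Lx) xz Iz).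
Qed.

Lemma step_convex (j : 'I_m) : order_convex (step j).
Proof.
have jm := ltn_ord j; have LE : step j = L j by rewrite /L jm.
rewrite LE => x y z Lx Lz xy yz; apply: (L_up xy) => //.
exact: (cset_convex (L_D Lx) (L_D Lz) xy yz).
Qed.

Lemma last_convex : order_convex last.
Proof.
have LE : last = L m by rewrite /L ltnn eqxx.
rewrite LE => x y z Lx Lz xy yz; apply: (L_up xy) => //.
exact: (cset_convex (L_D Lx) (L_D Lz) xy yz).
Qed.

Variable N : pmod T K.
Let Y : pmod T K := N ⊕ ⨁_(j : 'I_m.+1) imod K (D j).
Variable f : pmor Y (imod K I).
Hypothesis fE : forall x (u : Y x), fiber_val (f x u) =
  if `[< (I : set T) x >] then \sum_(j < m.+1) fiber_val (dsum_val u.2 j) else 0.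

Let X : pmod T K := N ⊕ imod K (ConvexSubset (@last_convex))
  ⊕ ⨁_(j : 'I_m) imod K (ConvexSubset (@step_convex j)).

(** The coordinates of [X] sit in two separate summands; a single numbering, with [last] at index
    [m], makes the sums telescope. *)
Definition kval x (u : X x) (j : nat) : K :=
  if insub j is Some i then fiber_val (dsum_val u.2 (i : 'I_m))
  else if j == m then fiber_val u.1.2 else 0.

Lemma kval_ord x (u : X x) (j : 'I_m) : kval u j = fiber_val (dsum_val u.2 j).
Proof. by rewrite /kval valK. Qed.

Lemma kval_last x (u : X x) : kval u m = fiber_val u.1.2.
Proof. by rewrite /kval insubF ?ltnn // eqxx. Qed.

Lemma kval_lin x k (u v : X x) j : kval (k *: u + v) j = k * kval u j + kval v j.
Proof.
rewrite /kval; case: insub => //; case: eqP => //; by rewrite mulr0 addr0.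
Qed.

Lemma kval_L x (u : X x) j : kval u j != 0 -> L j x.
Proof.
rewrite /kval /L; case: insubP => [i -> <-|/negbTE->]; first by move=> /fiber_in.
by case: (j =P m) => [_ /fiber_in|_ /eqP].
Qed.

Lemma kval_map x y (xy : (x <= y)%O) (u : X x) j :
  kval (pmap X xy u) j = if `[< L j y >] then kval u j else 0.
Proof.
rewrite /kval /L; case: insubP => [i -> <- //|/negbTE->].
by case: (j =P m) => // _; rewrite if_same.
Qed.

Lemma kval_inj x (u v : X x) : u.1.1 = v.1.1 ->
  (forall j, (j <= m)%N -> kval u j = kval v j) -> u = v.
Proof.
move: u v => [[n u1] u2] [[n' v1] v2] /= -> uv; congr (_, _, _).
  by apply: fiber_val_inj; have := uv m (leqnn m); rewrite !kval_last.
apply: dsum_valP => j; apply: fiber_val_inj.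
by have := uv j (ltnW (ltn_ord j)); rewrite !kval_ord.
Qed.

(* The generator of the summand L j at x goes to e_j - e_(j+1), where e_(j+1) is
   read as 0 if x is not in D j.+1; the inverse takes partial sums. *)
Definition kdiff x (u : X x) (j : nat) : K :=
  kval u j - (if j is j'.+1 then kval u j' else 0).

Lemma kdiff_lin x k (u v : X x) j : kdiff (k *: u + v) j = k * kdiff u j + kdiff v j.
Proof.
rewrite /kdiff kval_lin; case: j => [|j]; rewrite ?kval_lin ?subr0 //.
by rewrite mulrBr opprD addrACA.
Qed.

Lemma sum_kdiff x (u : X x) j : \sum_(i < j.+1) kdiff u i = kval u j.
Proof.
elim: j => [|j IH]; first by rewrite big_ord1 /kdiff subr0.
by rewrite big_ord_recr /= IH /kdiff addrC subrK.
Qed.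

Definition kmap_fun x (u : X x) : Y x :=
  (u.1.1, dsum_mk (fun j : 'I_m.+1 => fiber_mk (D j) x (kdiff u j))).

Fact kmap_is_linear x : linear (@kmap_fun x).
Proof.
move=> k u v; congr (_, _); apply: dsum_valP => j; rewrite dsum_val_lin /=.
by rewrite -fiber_mk_is_linear kdiff_lin.
Qed.
HB.instance Definition _ x := GRing.isLinear.Build K (X x) (Y x) _
  (@kmap_fun x) (@kmap_is_linear x).

Fact kmap_nat x y (xy : (x <= y)%O) (u : X x) :
  kmap_fun (pmap X xy u) = pmap Y xy (kmap_fun u).
Proof.
congr (_, _); apply: dsum_valP => j; apply: fiber_val_inj => /=.
case: (asboolP ((D j : set T) y)) => // Dy.
have val i : (D i : set T) y -> (i <= m)%N -> kval (pmap X xy u) i = kval u i.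
  move=> Diy im; rewrite kval_map; case: asboolP => // nL.
  by apply/esym/eqP; apply: contra_notT nL => /kval_L Lx; exact: L_up Lx Diy.
have jm : (j <= m)%N by rewrite -ltnS ltn_ord.
have -> : kdiff (pmap X xy u) j = kdiff u j.
  rewrite /kdiff val //; case: (nat_of_ord j) Dy jm => [|i] Dy jm; first by [].
  by rewrite val //; [exact: DS | exact: ltnW].
(* At [x] outside [D j] both terms of the difference vanish: the first since [L j] is inside [D j],
   the second by [L_next]. *)
case: asboolP => // nD; apply: subr0_eq; rewrite subr0 /kdiff.
have [->|/kval_L/L_D//] := eqVneq (kval u j) 0.
case: (nat_of_ord j) nD Dy jm => [|i] nD Dy jm; rewrite ?subr0 //.
have [->|/kval_L Lx] := eqVneq (kval u i) 0; rewrite ?subr0 //.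
by case: nD; exact: L_next Lx Dy.
Qed.
Definition kmap : pmor X Y :=
  @PMor _ _ _ X Y (fun x => (@kmap_fun x : {linear _ -> _})) kmap_nat.

Definition wval x (w : Y x) (i : nat) : K := fiber_val (dsum_val w.2 (inord i)).
Definition wsum x (w : Y x) (j : nat) : K := \sum_(i < j.+1) wval w i.
Definition kinv x (w : Y x) : X x :=
  (w.1, fiber_mk last x (wsum w m),
   dsum_mk (fun j : 'I_m => fiber_mk (step j) x (wsum w j))).

Lemma kval_kinv x (w : Y x) j : (j <= m)%N ->
  kval (kinv w) j = if `[< L j x >] then wsum w j else 0.
Proof.
rewrite /kval /L; case: insubP => [i -> <- //|]; rewrite -leqNgt => mj jm.
have -> : j = m by apply/eqP; rewrite eqn_leq jm.
by rewrite ltnn eqxx.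
Qed.

Lemma wval_D x (w : Y x) j : (j <= m)%N -> wval w j != 0 -> (D j : set T) x.
Proof. by move=> jm /fiber_in; rewrite inordK. Qed.

Lemma wval_kmap x (u : X x) j : (j <= m)%N -> (D j : set T) x ->
  wval (kmap x u) j = kdiff u j.
Proof. by move=> jm Dx; rewrite /wval /= inordK //; case: asboolP. Qed.

Lemma kmapK x : cancel (kmap x) (@kinv x).
Proof.
move=> u; apply: kval_inj => // j jm; rewrite kval_kinv //.
case: asboolP => [Lx|nL]; last by apply/esym/eqP; apply: contra_notT nL => /kval_L.
rewrite -sum_kdiff; apply: eq_bigr => i _.
have ij : (i <= j)%N by rewrite -ltnS.
rewrite wval_kmap ?(leq_trans ij) //.
by apply: chain_sub (L_D Lx); rewrite ij.
Qed.

Lemma f_wsum x (w : Y x) : (I : set T) x -> fiber_val (f x w) = wsum w m.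
Proof.
move=> Ix; rewrite fE; case: asboolP => // _; apply: eq_bigr => i _.
by rewrite /wval inord_val.
Qed.

(** On the kernel, cutting the partial sum down to [L j] loses nothing: a point of [D j] outside
    [L j] lies in [I] and in no later interval, so the partial sum is already the full sum, which is
    the zero value of [f]. *)
Lemma wsum_D x (w : Y x) j : f x w = 0 -> (j <= m)%N -> (D j : set T) x ->
  kval (kinv w) j = wsum w j.
Proof.
move=> fw jm Dx; rewrite kval_kinv //; case: asboolP => // nL.
have [Ix nD] : (I : set T) x /\ ((j < m)%N -> ~ (D j.+1 : set T) x).
  split=> [|jlt /(L_predI jlt)//]; apply: contrapT => nI; apply: nL.
  rewrite /L; case: ltngtP jm => // [jlt _|jE _]; split=> //; first by move=> [].
  by rewrite -jE.
transitivity (wsum w m); first by rewrite -f_wsum // fw.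
rewrite /wsum -!(big_mkord xpredT (wval w)) (big_cat_nat (n := j.+1)) //=.
rewrite [X in _ + X]big_nat [X in _ + X]big1 ?addr0 // => i /andP[ji im].
apply/eqP; apply: contra_notT (nD (leq_trans ji im)) => /wval_D -/(_ im).
by apply: chain_sub; rewrite ji.
Qed.

Lemma kmap_kinv x (w : Y x) : f x w = 0 -> kmap x (kinv w) = w.
Proof.
move=> fw; case: w fw => n w fw; congr (_, _); apply: dsum_valP => j.
apply: fiber_val_inj => /=; have jm : (j <= m)%N by rewrite -ltnS ltn_ord.
case: asboolP => [Dx|nD]; last by rewrite fiber_out.
rewrite /kdiff wsum_D //.
have -> : fiber_val (dsum_val w j) = wval ((n, w) : Y x) j by rewrite /wval inord_val.
case: (nat_of_ord j) Dx jm => [|i] Dx jm; first by rewrite /wsum big_ord1 subr0.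
rewrite wsum_D ?(ltnW jm) //; last exact: DS.
by rewrite [wsum _ i.+1]big_ord_recr /= addrC addrK.
Qed.

Lemma f_kmap x (u : X x) : f x (kmap x u) = 0.
Proof.
apply: fiber_val_inj; have [Ix|nI] := pselect ((I : set T) x); last by rewrite fiber_out.
rewrite f_wsum // [RHS]/=.
have -> : wsum (kmap x u) m = \sum_(i < m.+1) kdiff u i.
  apply: eq_bigr => i _; have im : (i <= m)%N by rewrite -ltnS ltn_ord.
  have [Dx|nD] := pselect ((D i : set T) x); first exact: wval_kmap.
  rewrite /wval /= inordK //; case: asboolP => // _; apply/esym.
  rewrite /kdiff; have [->|/kval_L/L_D//] := eqVneq (kval u i) 0.
  case: (nat_of_ord i) nD im => [|j] nD jm; rewrite ?subr0 //.
  have [->|/kval_L Lx] := eqVneq (kval u j) 0; rewrite ?subr0 //.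
  by case: nD; exact: L_stepD.
(* The sum has telescoped to coordinate [m], and [L m] misses [I]. *)
rewrite sum_kdiff; apply/eqP; apply: contraTT isT => /kval_L/L_last.
by [].
Qed.

Lemma chain_kernel (M : pmod T K) (theta : piso M Y) (g : pmor M (imod K I)) :
  (forall x u, f x u = g x (piso_inv theta x u)) -> pker g ≅ X.
Proof.
move=> fg; apply: (pker_iso (p := piso_inv theta \oP kmap)
  (g := fun x u => kinv (theta x u))) => x u.
- by rewrite pmor_compE -fg f_kmap.
- by rewrite pmor_compE piso_invK kmapK.
- move=> gu; rewrite pmor_compE kmap_kinv ?piso_funK //.
  by rewrite fg piso_funK.
Qed.
End ChainKernel.

(** * Elimination of the redundant summands *)

Section Reduction.
Context {d : Order.disp_t} (T : orderType d) (K : fieldType).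

Fact pmor0_nat (M N : pmod T K) x y (xy : (x <= y)%O) (v : M x) :
  (\0 : {linear M y -> N y}) (pmap M xy v) = pmap N xy ((\0 : {linear M x -> N x}) v).
Proof. by rewrite /= linear0. Qed.
Definition pmor0 (M N : pmod T K) : pmor M N := PMor (@pmor0_nat M N).

Variables (A B : choiceType) (S : B -> posetInterval T) (I : posetInterval T).
Variables (iota : A -> B) (c : B -> K).
Variables (h : pmor (⨁_(b : B) imod K (S b)) (imod K I)).
Hypothesis iota_inj : injective iota.
Hypothesis hE : forall b x (v : imod K (S b) x),
  fiber_val (h x (pbigsum_in (fun b => imod K (S b)) b x v)) =
  if `[< (I : set T) x >] then c b * fiber_val v else 0.
Hypothesis cI : forall b, c b != 0 -> interval_le (I : set T) (S b).
Hypothesis c_iota : forall a, c (iota a) != 0.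
Hypothesis cover : forall b, c b != 0 ->
  exists a, interval_le (S (iota a) : set T) (S b).

Let V b : pmod T K := imod K (S b).
Let incl := split_incl V iota (fun a => c (iota a)).

Lemma h_incl_in a x (v : V (iota a) x) :
  fiber_val (h x (incl x (pbigsum_in (fun a => V (iota a)) a x v))) =
  if `[< (I : set T) x >] then fiber_val v else 0.
Proof.
rewrite /incl split_incl_in linearZZ fiber_valZ hE.
by case: asboolP => _; rewrite ?mulr0 // mulKf.
Qed.

(** The correction is [c b] times the canonical map to a kept summand below [S b], since kept
    summands are rescaled to coefficient 1. *)
Lemma correction_exists b : exists q : pmor (V b) (⨁_(a : A) V (iota a)),
  forall x (v : V b x), h x (incl x (q x v)) = h x (pbigsum_in V b x v).
Proof.
have [cb|cb] := eqVneq (c b) 0.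
  exists (pmor0 _ _) => x v /=; rewrite !linear0; apply: fiber_val_inj.
  by rewrite hE cb mul0r if_same.
have [a ab] := cover cb.
exists (pmor_scale (pbigsum_in (fun a => V (iota a)) a \oP
  imod_can K (interval_le_can_nat ab)) (c b)) => x v.
rewrite pmor_scaleE pmor_compE !linearZZ; apply: fiber_val_inj.
rewrite fiber_valZ h_incl_in hE; case: asboolP => // [Ix|_]; last exact: mulr0.
rewrite /=; case: asboolP => // nS.
have [->//|/fiber_in Sx] := eqVneq (fiber_val v) 0.
(* A point of [S b] and [I] lies in the kept interval: that interval has a point below it as it
   precedes [S b], and one above it as [I] precedes it. *)
have [_ /(_ _ Sx)[z Sz zx]] := ab; have [/(_ _ Ix)[t St xt] _] := cI (c_iota a).
by case: nS; exact: (cset_convex Sz St zx xt).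
Qed.

Lemma reduction (M : pmod T K) (f : pmor M (imod K I))
    (phi : piso M (⨁_(b : B) imod K (S b))) :
    (forall x u, h x u = f x (piso_inv phi x u)) ->
  exists (N : pmod T K) (theta : piso M (N ⊕ ⨁_(a : A) V (iota a))),
    [/\ interval_decomposable N,
        forall x (u : N x), f x (piso_inv theta x (pinl _ _ x u)) = 0 &
        forall a x (v : V (iota a) x),
          fiber_val (f x (piso_inv theta x
            (pinr _ _ x (pbigsum_in (fun a => V (iota a)) a x v)))) =
          if `[< (I : set T) x >] then fiber_val v else 0].
Proof.
move=> hf.
pose corr (e : outside iota) := sval (cid (correction_exists (outside_val e))).
have corrE e : forall x v, h x (incl x (corr e x v)) = _ :=
  svalP (cid (correction_exists (outside_val e))).
pose theta0 := split_iso iota_inj corr c_iota.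
exists _, (piso_comp theta0 phi); split.
- exists (outside iota), (fun e => S (outside_val e)); constructor; exact: piso_id.
- move=> x u.
  apply: (pbigsum_ext (f := f \oP (piso_inv (piso_comp theta0 phi) \oP pinl _ _))
    (g := pmor0 _ _)) => e v.
  rewrite pmor_compE [RHS]/= /piso_comp [piso_inv _]/(_ \oP _) !pmor_compE -hf.
  rewrite [piso_inv theta0]/(split_bwd _ _) split_bwd_inl linearB corrE subrr.
  by [].
- move=> a x v; rewrite [piso_inv _]/(_ \oP _) pmor_compE -hf.
  by rewrite [piso_inv theta0]/(split_bwd _ _) split_bwd_inr h_incl_in.
Qed.
End Reduction.

(** * Support and coordinates of the reduced map *)

Section ReducedMap.
Context {d : Order.disp_t} (T : orderType d) (K : fieldType).
Variables (M N : pmod T K) (A : choiceType) (S : A -> posetInterval T).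
Variables (I : posetInterval T) (f : pmor M (imod K I)).
Variable theta : piso M (N ⊕ ⨁_(a : A) imod K (S a)).
Let M' : pmod T K := ⨁_(a : A) imod K (S a).
Let F := f \oP piso_inv theta.
Hypothesis fN : forall x (u : N x), F x (pinl N M' x u) = 0.
Hypothesis fA : forall a x (v : imod K (S a) x),
  fiber_val (F x (pinr N M' x (pbigsum_in (fun a => imod K (S a)) a x v))) =
  if `[< (I : set T) x >] then fiber_val v else 0.

Lemma padd_split x (u : (N ⊕ M') x) : u = pinl N M' x u.1 + pinr N M' x u.2.
Proof. by case: u => u w; congr (_, _); rewrite /= ?addr0 ?add0r. Qed.

Lemma reduced_support x : (I : set T) x ->
  (\bigcup_a (S a : set T)) x <-> exists v, fiber_val (f x v) != 0.
Proof.
move=> Ix; split=> [[a _ Sx]|[v]].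
  exists (piso_inv theta x (pinr N M' x
    (pbigsum_in (fun a => imod K (S a)) a x (fiber_mk (S a) x (1 : K))))).
  have /= := fA (fiber_mk (S a) x (1 : K)) => ->.
  by do 2 case: asboolP => //; rewrite oner_eq0.
apply: contra_neqP => nS; rewrite -(piso_funK theta v) [theta x v]padd_split.
rewrite -pmor_compE linearD fN add0r.
suff -> : F x (pinr N M' x (theta x v).2) = 0 by [].
apply: (pbigsum_ext (f := F \oP pinr N M') (g := pmor0 _ _)) => a u.
apply: fiber_val_inj; rewrite pmor_compE fA fiber_out ?if_same // => Sx.
by apply: nS; exists a.
Qed.
End ReducedMap.

Lemma reduced_sum {d} (T : orderType d) (K : fieldType) (M N : pmod T K) n
    (S : 'I_n -> posetInterval T) (I : posetInterval T) (f : pmor M (imod K I))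
    (theta : piso M (N ⊕ ⨁_(a : 'I_n) imod K (S a))) :
    (forall x (u : N x), f x (piso_inv theta x (pinl _ _ x u)) = 0) ->
    (forall a x (v : imod K (S a) x),
      fiber_val (f x (piso_inv theta x
        (pinr _ _ x (pbigsum_in (fun a => imod K (S a)) a x v)))) =
      if `[< (I : set T) x >] then fiber_val v else 0) ->
  forall x u, fiber_val ((f \oP piso_inv theta) x u) =
    if `[< (I : set T) x >] then \sum_(j < n) fiber_val (dsum_val u.2 j) else 0.
Proof.
move=> fN fA x u; rewrite {1}[u]padd_split linearD pmor_compE fN add0r.
rewrite [u.2 in LHS](@dsum_decomp _ _ _ _ (enum 'I_n)) ?enum_uniq; last first.
- by move=> j; rewrite mem_enum.
- by [].
rewrite !linear_sum.
transitivity (\sum_(j <- enum 'I_n) if `[< (I : set T) x >]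
    then fiber_val (dsum_val u.2 j) else 0).
  rewrite (big_morph (@fiber_val _ _ _ _ _) (id1 := 0) (op1 := +%R)) //.
  by apply: eq_bigr => j _; exact: fA.
rewrite big_enum /=; case: asboolP => // _; exact: big1.
Qed.


(* Assembly of the decomposition *)
Local Close Scope ring_scope.
Theorem theorem1p10 (R : realType) (P : set R) (K : fieldType)
    (M : pmod (subposet P) K) (I : posetInterval (subposet P))
    (f : pmor M (imod K I)) :
  interval_decomposable M ->
  ~ pmor_zero f ->
  exists (A : choiceType) (N : pmod (subposet P) K)
      (MA : A -> posetInterval (subposet P))
      (theta : piso M (N ⊕ ⨁_(a : A) imod K (MA a))),
    [/\ interval_decomposable N,
        pmor_zero (f \oP piso_inv theta \oP pinl N (⨁_(a : A) imod K (MA a))) /\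
        (forall a : A,
          [/\ interval_le I (MA a),
              (MA a : set (subposet P)) `&` I !=set0 &
              ~ pmor_zero (f \oP piso_inv theta \oP
                  (pinr N (⨁_(a : A) imod K (MA a)) \oP
                   pbigsum_in (fun a : A => imod K (MA a)) a))]),
        exists cvx : order_convex (I `\` \bigcup_a (MA a : set (subposet P))),
          pcoker f ≅ imod K (ConvexSubset cvx) &
        finite_set [set: A] ->
        exists (n : nat) (J : nat -> posetInterval (subposet P)),
          [/\ (1 <= n)%N /\
              (⨁_(a : A) imod K (MA a)) ≅ (⨁_(j : 'I_n) imod K (J j.+1)),
              forall j : nat, (1 <= j < n)%N -> interval_Supset (J j) (J j.+1),
              ~ has_ubound (I : set (subposet P)) -> n = 1%N,
              exists cvx : order_convex (I `\` J 1),
                pcoker f ≅ imod K (ConvexSubset cvx) &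
              exists (cvx_last : order_convex (J n `\` I))
                (cvx_step : forall j : 'I_n.-1,
                  order_convex (J j.+1 `\` ((J j.+1 `\` J j.+2) `&` I))),
                pker f ≅ N ⊕ imod K (ConvexSubset cvx_last) ⊕
                         ⨁_(j : 'I_n.-1) imod K (ConvexSubset (cvx_step j))]].
Proof.
move=> [B [S [phi]]] f_nz.
pose V b : pmod (subposet P) K := imod K (S b).
pose h := f \oP piso_inv phi.
have [c cP] := choice (fun b =>
  let: ex_intro2 c h1 h2 := imod_hom_coef (h \oP pbigsum_in V b) in
  ex_intro _ c (conj h1 h2)).
have hE b x (v : V b x) : fiber_val (h x (pbigsum_in V b x v)) =
    if `[< (I : set (subposet P)) x >] then (c b * fiber_val v)%R else 0%R.
  by have [+ _] := cP b; exact.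
have cI b : c b != 0%R -> interval_le (I : set (subposet P)) (S b).
  by have [_ cb] := cP b; move=> /cb[].
have cI0 b : c b != 0%R -> (S b : set (subposet P)) `&` I !=set0.
  by have [_ cb] := cP b; move=> /cb[].
have hf x u : h x u = f x (piso_inv phi x u) by [].
(* This is where [f] nonzero enters; it makes the chain nonempty, and [b0] serves as the default of
   [nth]. *)
have [b0 cb0] : exists b0, c b0 != 0%R.
  apply: contrapT => nc; apply: f_nz => x v; rewrite -(piso_funK phi v) -hf.
  apply: (pbigsum_ext (f := h) (g := pmor0 _ _)) => b u.
  apply: fiber_val_inj; rewrite hE.
  have [->|cb] := eqVneq (c b) 0%R; last by case: nc; exists b.
  by rewrite GRing.mul0r if_same.
have finish (A : choiceType) (iota : A -> B) (iota_inj : injective iota)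
    (c_iota : forall a, c (iota a) != 0%R)
    (cover : forall b, c b != 0%R ->
      exists a, interval_le (S (iota a) : set (subposet P)) (S b)) :
  exists (N : pmod (subposet P) K) (theta : piso M (N ⊕ ⨁_(a : A) V (iota a))),
    [/\ interval_decomposable N,
        forall x (u : N x), f x (piso_inv theta x (pinl _ _ x u)) = 0%R,
        forall a x (v : V (iota a) x),
          fiber_val (f x (piso_inv theta x
            (pinr _ _ x (pbigsum_in (fun a => V (iota a)) a x v)))) =
          if `[< (I : set (subposet P)) x >] then fiber_val v else 0%R &
        (forall a : A,
          [/\ interval_le I (S (iota a)),
              (S (iota a) : set (subposet P)) `&` I !=set0 &
              ~ pmor_zero (f \oP piso_inv theta \oP
                  (pinr N (⨁_(a : A) V (iota a)) \oP
                   pbigsum_in (fun a : A => V (iota a)) a))])].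
  have [N [theta [Nint fN fA]]] := reduction iota_inj hE cI c_iota cover hf.
  exists N, theta; split=> // a; split; [exact: cI|exact: cI0|].
  move=> z; have [x [Sx Ix]] := cI0 _ (c_iota a).
  have := fA a x (fiber_mk (S (iota a)) x (1%R : K)).
  have /= -> := z x (fiber_mk (S (iota a)) x (1%R : K)).
  do 2 case: asboolP => // _; move/esym/eqP.
  by rewrite GRing.oner_eq0.
have [fin|infin] := pselect (finite_set [set b | c b != 0%R]); last first.
  (* Infinite case: every summand with nonzero scalar is kept and covers itself, and the clause on
     finite [A] is vacuous. *)
  pose A : choiceType := {b : B | c b != 0%R}.
  have [||N [theta [Nint fN fA rest]]] := finish A val val_inj.
  - by move=> a; exact: (valP a).
  - by move=> b cb; exists (exist _ b cb); exact: interval_le_refl.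
  exists A, N, (fun a : A => S (val a)), theta; split=> //.
    exact: (pcoker_imod (reduced_support fN fA)).
  move=> finA; case: infin.
  apply: sub_finite_set (finite_image val finA) => b cb.
  by exists (exist _ b cb).
pose s0 : seq B := finmap.enum_fset (fset_set [set b | c b != 0%R]).
have [s [s_sub s_pw s_cov]] := chain_exists S s0.
have in_s0 b : (b \in s0) = (c b != 0%R).
  by rewrite [LHS]in_fset_set //; apply/idP/idP; rewrite inE.
have [m sz] : exists m, size s = m.+1.
  have [|a as_ _] := s_cov b0; first by rewrite in_s0.
  by case: (s) as_ => // e s' _; exists (size s').
(* The intervals are numbered from 1 in the statement; [J 0] merely repeats [J 1]. *)
pose J k := S (nth b0 s k.-1).
pose iota (j : 'I_m.+1) := nth b0 s j.
have over i j : (i < j <= m)%N -> interval_Supset (J i.+1 : set (subposet P)) (J j.+1).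
  move=> /andP[ij jm]; apply/asboolP; apply: (elimT (pairwiseP b0) s_pw i j) => //.
    by rewrite inE sz ltnS (leq_trans (ltnW ij)).
  by rewrite inE sz ltnS.
have iota_inj : injective iota.
  move=> i j ij; apply/val_inj; apply: contrapT => /eqP; rewrite neq_ltn.
  have irr k : ~ interval_Supset (S k : set (subposet P)) (S k).
    by move/asboolP; rewrite -/(strict_over _ _) strict_over_irr.
  have jm (k : 'I_m.+1) : (k <= m)%N by rewrite -ltnS.
  case/orP => lt; [have := over i j|have := over j i];
    by rewrite lt jm /J /= -/(iota _) -/(iota _) ij => /(_ isT)/irr.
have c_nth j : (j <= m)%N -> c (nth b0 s j) != 0%R.
  by move=> jm; rewrite -in_s0; apply/s_sub/mem_nth; rewrite sz ltnS.
have [||N [theta [Nint fN fA rest]]] := finish 'I_m.+1 iota iota_inj.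
- by move=> a; apply: c_nth; rewrite -ltnS.
- move=> b cb; have [|a as_ ab] := s_cov b; first by rewrite in_s0.
  have ia : (index a s < m.+1)%N by rewrite -sz index_mem.
  by exists (Ordinal ia); rewrite /iota /= nth_index.
have cok := reduced_support fN fA.
(* The union of a nested chain is its outermost member, so the two descriptions of the cokernel
   agree. *)
have JE : \bigcup_(a in [set: 'I_m.+1]) (J a.+1 : set (subposet P)) = J 1.
  apply/seteqP; split=> [x [a _] Jx|x Jx]; last by exists ord0.
  have [a0|a0] := posnP a; first by rewrite a0 in Jx.
  have [sub _] : interval_Supset (J 1 : set (subposet P)) (J a.+1).
    by apply: over; rewrite a0 -ltnS ltn_ord.
  exact: sub.
exists 'I_m.+1, N, (fun a : 'I_m.+1 => J a.+1), theta; split=> //.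
  exact: pcoker_imod cok.
move=> _; exists m.+1, J; split.
- split=> //; constructor; exact: piso_id.
- move=> [//|j] /andP[_ jm]; apply: over.
  by rewrite ltnS leqnn -ltnS.
(* If there is a second interval, strict nesting gives a point [b] above all of it; as [I] precedes
   that interval, [b] bounds [I]. *)
- move=> nub; case: (posnP m) => [->//|m0]; case: nub.
  have [_ [a [b [_ _ ab]]]] := over 0 1 m0.
  exists b; move=> i Ii; have [le1 _] := cI _ (c_nth 1 m0).
  by have [j Jj ij] := le1 _ Ii; apply: le_trans ij (ltW _); have /andP[] := ab j Jj.
- by rewrite JE in cok; exact: pcoker_imod cok.
- have ID j : (j <= m)%N -> interval_le (I : set (subposet P)) (J j.+1) /\
      (J j.+1 : set (subposet P)) `&` I !=set0.
    by move=> /c_nth cj; split; [exact: cI | exact: cI0].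
  have DS j : (j < m)%N -> (J j.+2 : set (subposet P)) `<=` J j.+1.
    by move=> jm; have [] : interval_Supset (J j.+1 : set (subposet P)) (J j.+2)
      by apply: over; rewrite ltnSn.
  exists (@last_convex _ _ I (fun j => J j.+1) m ID),
    (fun j => @step_convex _ _ I (fun j => J j.+1) m ID j).
  exact: (@chain_kernel _ _ K I (fun j => J j.+1) m ID DS N _
    (reduced_sum fN fA) M theta f).
Qed.
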